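(* Let $k$ be a field, let $x\in\mathbb P^1=\mathbb P^1_k$ be a closed point of degree one, let $r$ be a positive integer, and let $\mathcal E=\bigoplus_{i=1}^n\mathcal O(d_i)$ be a vector bundle of rank $n$ on $\mathbb P^1$. Then a rank $n$ vector bundle $\mathcal E'$ on $\mathbb P^1$ is a Hecke modification of $\mathcal E$ at $x$ of weight $r$ if and only if there exists a function $\delta:\{1,\dots,n\}\to\{0,1\}$, supported on exactly $r$ indices, such that $\mathcal E'\cong\bigoplus_{i=1}^n\mathcal O(d_i-\delta(i))$. Furthermore, when $k=\mathbb F_q$ is a finite field, write $\mathcal E\cong\bigoplus_{i=1}^m\bigoplus_{j=1}^{\ell_i}\mathcal O(b_i)$ with $b_1<b_2<\dots<b_m$. Then, for $\mathcal E'\cong\bigoplus_{i=1}^n\mathcal O(d_i-\delta(i))$ with $\delta:\{1,\dots,n\}\to\{0,1\}$ a function supported on exactly $r$ indices, $$m_{x,r}(\mathcal E',\mathcal E)=q^{\alpha}\prod_{j=1}^m\#\mathrm{Gr}(\theta_j,\ell_j),$$ where $\theta_j=\#\{i\in\{1,\dots,n\}\mid d_i=b_j\text{ and }\delta(i)=1\}$ and $\alpha=\sum_{j=1}^m(\ell_j-\theta_j)\bigl(r-\sum_{i=1}^j\theta_i\bigr)$.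
   Context: $\mathcal K_x^{\oplus r}$ is the skyscraper sheaf supported at $x$ with stalk $\kappa(x)^{\oplus r}$, $\kappa(x)$ the residue field. A vector bundle $\mathcal E'$ is a Hecke modification of $\mathcal E$ at $x$ with weight $r$ if there is a short exact sequence $0\to\mathcal E'\to\mathcal E\to\mathcal K_x^{\oplus r}\to0$. When $k=\mathbb F_q$, the multiplicity $m_{x,r}(\mathcal E',\mathcal E)$ is the number of coherent subsheaves $\mathcal E''\subseteq\mathcal E$ with $\mathcal E''\cong\mathcal E'$ and $\mathcal E/\mathcal E''\cong\mathcal K_x^{\oplus r}$ (equivalently, the number of exact sequences $0\to\mathcal E''\to\mathcal E\to\mathcal K_x^{\oplus r}\to0$ with $\mathcal E''\cong\mathcal E'$, up to isomorphisms of the outer terms and the identity on $\mathcal E$). $\#\mathrm{Gr}(\theta,\ell)$ is the number of $\theta$-dimensional $\mathbb F_q$-subspaces of $\mathbb F_q^{\ell}$. *)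

(* Defs.v *)
(* The scheme P^1 over a field k, written as the topological space of its
   points together with its sheaf of regular functions, and sheaves of
   O-modules on it. *)
From HB Require Import structures.
From mathcomp Require Import all_boot all_order all_algebra.
From mathcomp Require Import generic_quotient ring_quotient.
From mathcomp Require Import finmap.
From mathcomp Require Import all_classical.
From mathcomp Require Import topology_structure.

Set Implicit Arguments.
Unset Strict Implicit.
Unset Printing Implicit Defensive.

Import Order.TTheory GRing.Theory Num.Theory.
Local Open Scope classical_set_scope.
Local Open Scope ring_scope.

(* The affine chart Spec k[t] contributes the generic point (0) and the primes
   (p), p monic irreducible; the remaining point is t = oo. *)
Inductive P1 (k : fieldType) :=
| Generic
| Finite (p : {poly k}) of p \is monic & irreducible_poly p
| Infinity.
Arguments Generic {k}.
Arguments Infinity {k}.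

HB.instance Definition _ (k : fieldType) := gen_eqMixin (P1 k).
HB.instance Definition _ (k : fieldType) := gen_choiceMixin (P1 k).

Definition zariski (k : fieldType) : set_system (P1 k) :=
  [set U | U = set0 \/ (U Generic /\ finite_set (~` U))].

Section Topology.
Variable k : fieldType.

Lemma zariskiT : zariski (setT : set (P1 k)).
Proof. by right; rewrite setCT; split => //; exact: finite_set0. Qed.

Lemma zariskiI : setI_closed (@zariski k).
Proof.
move=> U V [->|[U0 Uf]]; first by left; rewrite set0I.
case=> [->|[V0 Vf]]; first by left; rewrite setI0.
by right; split=> //; rewrite setCI finite_setU.
Qed.

Lemma zariski_bigU (I : Type) (f : I -> set (P1 k)) :
  (forall i, zariski (f i)) -> zariski (\bigcup_i f i).
Proof.
move=> fo; have [[i fi]|no] := pselect (exists i, f i !=set0).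
  right; have [fi0|[fG ff]] := fo i.
    by case: fi => y; rewrite fi0.
  split; first by exists i.
  by apply: sub_finite_set ff => y /= ny fy; apply: ny; exists i.
by left; rewrite -subset0 => y [i _ fy]; apply: no; exists i, y.
Qed.

HB.instance Definition _ :=
  isOpenTopological.Build (P1 k) zariskiT zariskiI zariski_bigU.

Lemma open_P1E (U : set (P1 k)) : open U = zariski U.
Proof. by []. Qed.
End Topology.

Record opens (k : fieldType) := Opens {
  opens_set :> set (P1 k);
  opens_open : open opens_set
}.

Lemma opensT_subproof (k : fieldType) : open (setT : set (P1 k)).
Proof. exact: openT. Qed.
Definition opensT (k : fieldType) : opens k := Opens (@opensT_subproof k).

(* Two non-empty opens meet, since both contain the generic point. *)
Lemma opens_generic (k : fieldType) (U : opens k) y :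
  opens_set U y -> opens_set U Generic.
Proof. by case: U => U /= Uo Uy; case: Uo => [U0|[]//]; rewrite U0 in Uy. Qed.

(* Restriction of functions along V `<=` U; functions on a set U are functions
   on the type of its elements, so there is a unique one when U is empty. *)
Definition incl (T : Type) (U V : set T) (h : V `<=` U) (y : V) : U :=
  exist _ (val y) (mem_set (h _ (set_mem (valP y)))).

Definition rst (T S : Type) (U V : set T) (h : V `<=` U) (s : U -> S) : V -> S :=
  fun y => s (incl h y).

Lemma rst_id (T S : Type) (U : set T) (h : U `<=` U) (s : U -> S) : rst h s = s.
Proof. by apply/funext => y; congr (s _); apply: val_inj. Qed.

Lemma rst_comp (T S : Type) (U V W : set T) (hVU : V `<=` U) (hWV : W `<=` V)
  (hWU : W `<=` U) (s : U -> S) : rst hWV (rst hVU s) = rst hWU s.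
Proof. by apply/funext => y; congr (s _); apply: val_inj. Qed.

Lemma rst_separated (T S I : Type) (U : set T) (W : I -> set T)
    (h : forall i, W i `<=` U) (s t : U -> S) :
  U `<=` \bigcup_i W i -> (forall i, rst (h i) s = rst (h i) t) -> s = t.
Proof.
move=> cov st; apply/funext => y.
have [i _ Wy] := cov _ (set_mem (valP y)).
have yE : incl (h i) (exist _ (val y) (mem_set Wy)) = y by apply: val_inj.
by rewrite -yE; exact: (congr1 (@^~ (exist _ (val y) (mem_set Wy))) (st i)).
Qed.

Lemma rst_glue (T S I : Type) (U : set T) (W : I -> set T)
    (h : forall i, W i `<=` U) (s : forall i, W i -> S) :
  U `<=` \bigcup_i W i ->
  (forall i j (y : W i) (z : W j), val y = val z -> s i y = s j z) ->
  exists t : U -> S, forall i, rst (h i) t = s i.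
Proof.
move=> cov st; have ex (y : U) : exists i, W i (val y).
  by have [i _ Wy] := cov _ (set_mem (valP y)); exists i.
pose idx y := projT1 (cid (ex y)); have idxP y : W (idx y) (val y) := projT2 (cid (ex y)).
exists (fun y => s (idx y) (exist _ (val y) (mem_set (idxP y)))) => i.
by apply/funext => y; apply: st.
Qed.

Section StructureSheaf.
Variable k : fieldType.
Local Notation K := {fraction {poly k}}.
Local Notation "a %:F" := (@FracField.tofrac {poly k} a).
Implicit Types (x : P1 k) (U V W : opens k).

(* The local ring O_{P^1,x}, a subring of the function field k(t). *)
Definition local_ring x : set K :=
  match x with
  | Generic => setT
  | Finite p _ _ => [set f | exists a b : {poly k}, ~~ (p %| b) /\ f = a%:F / b%:F]
  | Infinity => [set f | exists a b : {poly k},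
      [/\ b != 0, (size a <= size b)%N & f = a%:F / b%:F]]
  end.

Lemma irreducible_dvdpM (p a b : {poly k}) :
  irreducible_poly p -> ~~ (p %| a) -> ~~ (p %| b) -> ~~ (p %| a * b).
Proof.
by move=> pI; rewrite -!irreducible_poly_coprime // coprimepMr => -> ->.
Qed.

Lemma local_ring_closed x : subring_closed (mem (local_ring x)).
Proof.
have K0 (a : {poly k}) : (a%:F == 0) = (a == 0) by exact: tofrac_eq0.
have subE (a b c d : {poly k}) : b != 0 -> d != 0 ->
    a%:F / b%:F - c%:F / d%:F = (a * d - c * b)%:F / (b * d)%:F.
  move=> b0 d0; rewrite tofracB !tofracM -mulNr addf_div ?K0//.
  by rewrite mulNr.
have mulE (a b c d : {poly k}) :
    a%:F / b%:F * (c%:F / d%:F) = (a * c)%:F / (b * d)%:F.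
  by rewrite !tofracM mulf_div.
case: x => [|p pm pI|]; split.
- by rewrite inE.
- by move=> f g _ _; rewrite inE.
- by move=> f g _ _; rewrite inE.
- rewrite inE; exists 1, 1; split; last by rewrite tofrac1 divr1.
  by rewrite dvdp1 neq_ltn pI.1 orbT.
- have nz (b : {poly k}) : ~~ (p %| b) -> b != 0.
    by apply: contraNneq => ->; rewrite dvdp0.
  move=> f g; rewrite !inE => -[a [b [pb ->]]] [c [d [pd ->]]].
  exists (a * d - c * b), (b * d); split; first exact: irreducible_dvdpM.
  exact: subE (nz _ pb) (nz _ pd).
- move=> f g; rewrite !inE => -[a [b [pb ->]]] [c [d [pd ->]]].
  by exists (a * c), (b * d); split; [exact: irreducible_dvdpM|exact: mulE].
- rewrite inE; exists 1, 1; split=> //; first exact: oner_neq0.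
  by rewrite tofrac1 divr1.
- move=> f g; rewrite !inE => -[a [b [b0 ab ->]]] [c [d [d0 cd ->]]].
  exists (a * d - c * b), (b * d); split; [exact: mulf_neq0| |exact: subE].
  rewrite (leq_trans (size_polyD _ _))// size_polyN geq_max.
  have sz (u v w : {poly k}) : w != 0 -> (size u <= size v)%N ->
      (size (u * w)%R <= size (v * w)%R)%N.
    move=> w0 uv; have [->|u0] := eqVneq u 0; first by rewrite mul0r size_poly0.
    have v0 : v != 0 by rewrite -size_poly_gt0 (leq_trans _ uv)// size_poly_gt0.
    by rewrite !size_mul// -!subn1 leq_sub2r// leq_add2r.
  by rewrite sz// [b * d]mulrC sz.
- move=> f g; rewrite !inE => -[a [b [b0 ab ->]]] [c [d [d0 cd ->]]].
  exists (a * c), (b * d); split; [exact: mulf_neq0| |exact: mulE].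
  have [->|a0] := eqVneq a 0; first by rewrite mul0r size_poly0.
  have [->|c0] := eqVneq c 0; first by rewrite mulr0 size_poly0.
  by rewrite !size_mul// -!subn1 leq_sub2r// leq_add.
Qed.

Lemma function_fieldE (f : K) :
  exists a b : {poly k}, b != 0 /\ f = a%:F / b%:F.
Proof.
elim/quotW: f => r; exists (\n_r), (\d_r); split; first exact: denom_ratioP.
apply: (canRL (mulfK _)); first by rewrite tofrac_eq0 denom_ratioP.
rewrite !piE; apply/eqP; rewrite eqmodE /= FracField.equivfE /FracField.mulf.
by rewrite !numden_Ratio ?mulf_neq0 ?denom_ratioP ?oner_eq0// ?mulr1 // mulrC.
Qed.

Lemma local_ring_val x (f : K) : local_ring x f \/ local_ring x f^-1.
Proof.
have [a [b [b0 ->]]] := function_fieldE f; rewrite invf_div.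
case: x => [|p pm pI|]; first by left.
- have [a0|a0] := eqVneq a 0.
    left; exists 0, 1; split; first by rewrite dvdp1 neq_ltn pI.1 orbT.
    by rewrite a0 tofrac0 !mul0r.
  set g := gcdp a b; have g0 : g != 0 by rewrite gcdp_eq0 negb_and a0.
  have aE : a = a %/ g * g by rewrite divpK// dvdp_gcdl.
  have bE : b = b %/ g * g by rewrite divpK// dvdp_gcdr.
  have cop : coprimep (a %/ g) (b %/ g) by apply: coprimep_div_gcd; rewrite a0.
  have g0F : g%:F != 0 by rewrite tofrac_eq0.
  have fE : a%:F / b%:F = (a %/ g)%:F / (b %/ g)%:F.
    rewrite {1}aE {1}bE !tofracM; by rewrite invfM mulrACA mulfV// mulr1.
  have fE' : b%:F / a%:F = (b %/ g)%:F / (a %/ g)%:F.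
    by rewrite -[RHS]invf_div -fE invf_div.
  case: (boolP (p %| b %/ g)) => pb; last by left; exists (a %/ g), (b %/ g).
  right; exists (b %/ g), (a %/ g); split=> //; apply/negP => pa.
  have : p %| gcdp (a %/ g) (b %/ g) by rewrite dvdp_gcd pa pb.
  have cop1 : gcdp (a %/ g) (b %/ g) %= 1 by rewrite gcdp_eqp1.
  by rewrite (eqp_dvdr _ cop1) dvdp1 (gtn_eqF pI.1).
- have [ab|/ltnW ba] := leqP (size a) (size b).
    by left; exists a, b.
  have [a0|a0] := eqVneq a 0; last first.
    by right; exists b, a.
  by left; exists a, b; split=> //; rewrite a0 size_poly0.
Qed.

Lemma local_ring_const x (c : k) : local_ring x (c%:P%:F).
Proof.
have cE : c%:P%:F = c%:P%:F / 1%:F by rewrite tofrac1 divr1.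
case: x => [|p pm pI|]; first by [].
- by exists c%:P, 1; split=> //; rewrite dvdp1 neq_ltn pI.1 orbT.
- exists c%:P, 1; split=> //; first exact: oner_neq0.
  by rewrite size_poly1 size_polyC leq_b1.
Qed.

Definition stalk_pred x : {pred K} := mem (local_ring x).
HB.instance Definition _ x :=
  GRing.isSubringClosed.Build K (@stalk_pred x) (local_ring_closed x).

Record stalk x := Stalk { stalk_val : K; stalkP : stalk_val \in stalk_pred x }.
HB.instance Definition _ x := [isSub for @stalk_val x].
HB.instance Definition _ x := [Choice of stalk x by <:].
HB.instance Definition _ x := [SubChoice_isSubComNzRing of stalk x by <:].

Definition max_ideal x : {pred stalk x} :=
  fun f => `[< ~ exists g : stalk x, f * g = 1 >].

Lemma max_ideal_closed x : idealr_closed (@max_ideal x).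
Proof.
split.
- by apply/asboolP => -[g]; rewrite mul0r => /esym/eqP; rewrite oner_eq0.
- by apply/negP => /asboolP; apply; exists 1; rewrite mulr1.
move=> a u v /asboolP nu /asboolP nv; apply/asboolP => -[g gE].
have [u0|u0] := eqVneq u 0.
  by apply: nv; exists g; rewrite -gE u0 mulr0 add0r.
have [v0|v0] := eqVneq v 0.
  by apply: nu; exists (a * g); rewrite -gE v0 addr0 mulrCA mulrA.
have val0 (w : stalk x) : w != 0 -> stalk_val w != 0.
  by move=> w0; apply: contraNneq w0 => w0; apply/eqP/val_inj.
have valM (w z : stalk x) : stalk_val (w * z) = stalk_val w * stalk_val z by [].
have [h|h] := local_ring_val x (stalk_val u / stalk_val v).
  have [w uE] : exists w, u = w * v.
    exists (Stalk (mem_set h)).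
    apply: val_inj; symmetry; apply: (etrans (valM _ _)).
    exact: (divfK (val0 v v0) (stalk_val u)).
  apply: nv; exists ((a * w + 1) * g).
  rewrite -[RHS]gE uE !mulrA; congr (_ * _).
  by rewrite mulrC mulrDl mul1r.
rewrite invf_div in h.
have [w vE] : exists w, v = w * u.
  exists (Stalk (mem_set h)).
  apply: val_inj; symmetry; apply: (etrans (valM _ _)).
  exact: (divfK (val0 u u0) (stalk_val v)).
apply: nu; exists ((a + w) * g).
rewrite -[RHS]gE vE !mulrA; congr (_ * _).
by rewrite mulrC mulrDl.
Qed.
HB.instance Definition _ x := isIdealr.Build (stalk x) (@max_ideal x) (@max_ideal_closed x).

Definition residue_field x := {ideal_quot (@max_ideal x)}.
HB.instance Definition _ x := GRing.ComNzRing.on (residue_field x).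

Definition residue x (f : stalk x) : residue_field x := \pi_(residue_field x)%qT f.

Definition const_stalk x (c : k) : stalk x := Stalk (mem_set (local_ring_const x c)).

(* [kappa(x) : k] = m *)
Definition degree x (m : nat) :=
  exists e : 'I_m -> residue_field x, forall u,
    exists! c : {ffun 'I_m -> k}, u = \sum_i residue (const_stalk x (c i)) * e i.

(* O(U): since P^1 is integral, a section over U is an element of k(t) lying in
   O_{P^1,y} for all y in U. Recording it as a constant function on U makes
   O(U) the zero ring when U is empty. *)
Definition regular_pred U : {pred (U -> K)} :=
  fun f => `[< (forall y z, f y = f z) /\ forall y, local_ring (val y) (f y) >].

Lemma regular_closed U : subring_closed (@regular_pred U).
Proof.
split.
- apply/asboolP; split=> // y.
  by have [/set_mem] := local_ring_closed (val y).
- move=> f g /asboolP[fc fl] /asboolP[gc gl]; apply/asboolP; split.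
    by move=> y z; rewrite !fctE (fc y z) (gc y z).
  move=> y; apply: set_mem; have [_ + _] := local_ring_closed (val y).
  by apply; apply: mem_set.
- move=> f g /asboolP[fc fl] /asboolP[gc gl]; apply/asboolP; split.
    by move=> y z; rewrite !fctE (fc y z) (gc y z).
  move=> y; apply: set_mem; have [_ _] := local_ring_closed (val y).
  by apply; apply: mem_set.
Qed.
HB.instance Definition _ U :=
  GRing.isSubringClosed.Build (U -> K) (@regular_pred U) (@regular_closed U).

Record regular U := Regular { reg_val : U -> K; regP : reg_val \in @regular_pred U }.
HB.instance Definition _ U := [isSub for @reg_val U].
HB.instance Definition _ U := [Choice of regular U by <:].
HB.instance Definition _ U := 
  GRing.SubChoice_isSubComPzRing.Build _ _ (regular U) (@regular_closed U).

Lemma reg_res_subproof U V (h : V `<=` U) (f : regular U) :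
  rst h (val f) \in @regular_pred V.
Proof.
have /asboolP[fc fl] := valP f; apply/asboolP; split=> [y z|y]; first exact: fc.
exact: fl (incl h y).
Qed.
Definition reg_res U V (h : V `<=` U) (f : regular U) : regular V :=
  Regular (reg_res_subproof h f).

Lemma reg_stalk_subproof x U (h : x \in opens_set U) (f : regular U) :
  val f (exist _ x h) \in @stalk_pred x.
Proof. by have /asboolP[_ fl] := valP f; apply: mem_set; exact: fl. Qed.
Definition germ x U (h : x \in opens_set U) (f : regular U) : stalk x :=
  Stalk (reg_stalk_subproof h f).

End StructureSheaf.

(* Sheaves of O-modules. The empty cover forces F(U) = 0 for U empty. *)
Record Omod (k : fieldType) := OMod {
  sec :> forall U : opens k, lmodType (regular U);
  res : forall U V : opens k, V `<=` U -> sec U -> sec V;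
  resP : forall (U V : opens k) (h : V `<=` U) (a : regular U) (s t : sec U),
    res h (a *: s + t) = reg_res h a *: res h s + res h t;
  res_id : forall (U : opens k) (h : U `<=` U) (s : sec U), res h s = s;
  res_comp : forall (U V W : opens k) (hVU : V `<=` U) (hWV : W `<=` V)
    (hWU : W `<=` U) (s : sec U), res hWV (res hVU s) = res hWU s;
  res_separated : forall (I : Type) (U : opens k) (W : I -> opens k)
    (h : forall i, W i `<=` U) (s t : sec U), U `<=` \bigcup_i W i ->
    (forall i, res (h i) s = res (h i) t) -> s = t;
  res_glue : forall (I : Type) (U : opens k) (W : I -> opens k)
    (h : forall i, W i `<=` U) (s : forall i, sec (W i)), U `<=` \bigcup_i W i ->
    (forall i j (V : opens k) (hi : V `<=` W i) (hj : V `<=` W j),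
       res hi (s i) = res hj (s j)) ->
    exists t : sec U, forall i, res (h i) t = s i
}.
Arguments res {k o U V}.

Record hom (k : fieldType) (F G : Omod k) := Hom {
  hom_map :> forall U : opens k, {linear F U -> G U};
  hom_res : forall (U V : opens k) (h : V `<=` U) (s : F U),
    hom_map V (res h s) = res h (hom_map U s)
}.

Definition iso (k : fieldType) (F G : Omod k) :=
  exists f : hom F G, forall U, bijective (f U).

(* s lies in the image sheaf of f *)
Definition in_image (k : fieldType) (F G : Omod k) (f : hom F G) (U : opens k)
    (s : G U) :=
  forall y, opens_set U y -> exists (V : opens k) (h : V `<=` U),
    opens_set V y /\ exists t, f V t = res h s.

Definition short_exact (k : fieldType) (F G H : Omod k) (i : hom F G)
    (p : hom G H) :=
  [/\ forall U, injective (i U),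
      forall U (s : G U), p U s = 0 <-> in_image i s
    & forall U (s : H U), in_image p s].

(* A tuple e of n sections over U is the same thing as a morphism O_U^n -> F_U. *)
Definition comb (k : fieldType) (F : Omod k) (U V : opens k) (h : V `<=` U) n
    (e : 'I_n -> F U) (c : 'rV[regular V]_n) : F V :=
  \sum_i c 0 i *: res h (e i).

Definition vector_bundle (k : fieldType) (n : nat) (F : Omod k) :=
  forall x, exists (U : opens k) (e : 'I_n -> F U),
    opens_set U x /\ forall (V : opens k) (h : V `<=` U), bijective (comb h e).

(* Locally there is an exact sequence O^m -> O^n -> F -> 0; P^1 is Noetherian,
   so this is the same as being quasi-coherent of finite type. *)
Definition coherent (k : fieldType) (F : Omod k) :=
  forall x, exists (U : opens k) m n (e : 'I_n -> F U) (A : 'M[regular U]_(m, n)),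
    [/\ opens_set U x,
        forall (V : opens k) (h : V `<=` U) (s : F V) y, opens_set V y ->
          exists (W : opens k) (hV : W `<=` V) (hU : W `<=` U),
            opens_set W y /\ exists c, res hV s = comb hU e c
      & forall (V : opens k) (h : V `<=` U) (c : 'rV[regular V]_n),
          comb h e c = 0 <->
          forall y, opens_set V y ->
          exists (W : opens k) (hV : W `<=` V) (hU : W `<=` U), opens_set W y /\
            exists b : 'rV[regular W]_m,
              map_mx (reg_res hV) c = b *m map_mx (reg_res hU) A].

Section Subsheaf.
Variables (k : fieldType) (F : Omod k).

(* sub_local: a section of F which is locally in the subsheaf belongs to it. *)
Record subsheaf := Subsheaf {
  sub_pred : forall U : opens k, {pred F U};
  sub_submod : forall U : opens k, submod_closed (@sub_pred U);
  sub_res : forall (U V : opens k) (h : V `<=` U) (s : F U),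
    s \in @sub_pred U -> res h s \in @sub_pred V;
  sub_local : forall (I : Type) (U : opens k) (W : I -> opens k)
    (h : forall i, W i `<=` U) (s : F U), U `<=` \bigcup_i W i ->
    (forall i, res (h i) s \in @sub_pred (W i)) -> s \in @sub_pred U
}.

Implicit Types (N : subsheaf) (U V W : opens k).

HB.instance Definition _ N U :=
  GRing.isSubmodClosed.Build (regular U) (F U) (@sub_pred N U)
    (GRing.submod_closed_semi (sub_submod N U)).

Record sub_sec N U := SubSec { sub_val : F U; sub_valP : sub_val \in @sub_pred N U }.
HB.instance Definition _ N U := [isSub for @sub_val N U].
HB.instance Definition _ N U := [Choice of sub_sec N U by <:].
HB.instance Definition _ N U := [SubChoice_isSubLmodule of sub_sec N U by <:].


Lemma subsheaf_res_subproof N U V (h : V `<=` U) (s : sub_sec N U) :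
  res h (val s) \in @sub_pred N V.
Proof. exact/sub_res/valP. Qed.
Definition subsheaf_res N U V (h : V `<=` U) (s : sub_sec N U) : sub_sec N V :=
  SubSec (subsheaf_res_subproof h s).

Definition sheaf_of_sub N : Omod k.
Proof.
refine (@OMod k (fun U => sub_sec N U) (@subsheaf_res N) _ _ _ _ _).
- by move=> U V h a s t; apply: val_inj; exact: resP.
- by move=> U h s; apply: val_inj; exact: res_id.
- by move=> U V W hVU hWV hWU s; apply: val_inj; exact: res_comp.
- move=> I U W h s t cov st; apply: val_inj; apply: (@res_separated k F I U W h _ _ cov) => i.
  exact: (congr1 (@sub_val N (W i)) (st i)).
- move=> I U W h s cov st.
  have [i j V hi hj|t tE] := @res_glue k F I U W h (fun i => sub_val (s i)) cov.
    exact: (congr1 (@sub_val N V) (st i j V hi hj)).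
  have tN : t \in @sub_pred N U.
    by apply: (@sub_local N I U W h _ cov) => i; rewrite tE; exact: valP.
  by exists (SubSec tN) => i; apply: val_inj; exact: tE.
Defined.

Definition sub_incl N : hom (sheaf_of_sub N) F.
Proof.
refine (@Hom k (sheaf_of_sub N) F (fun U => (val : {linear sub_sec N U -> F U})) _).
by [].
Defined.

End Subsheaf.

Section LineBundles.
Variable k : fieldType.
Local Notation K := {fraction {poly k}}.

(* The stalk of O(d) at x, sections of O(d) being written f(t) for the
   homogeneous rational function X0^d f(X1/X0), t = X1/X0: near t = oo it is
   regular when X0^d f / X1^d = f / t^d is. *)
Definition twist_stalk (d : int) (x : P1 k) : set K :=
  match x with
  | Infinity => [set f | local_ring Infinity
                   (f / (@FracField.tofrac {poly k} 'X) ^ d)]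
  | _ => local_ring x
  end.

Variables (I : finType) (d : I -> int).
Implicit Types U V W : opens k.

(* Sections over U of the direct sum of the O(d i), i in I. *)
Definition sumO_pred U : {pred (U -> I -> K)} := fun s =>
  `[< (forall y z, s y = s z) /\
      forall y i, twist_stalk (d i) (val y) (s y i) >].

Lemma twist_stalkE x (e : int) : exists2 c : K, c != 0 &
  twist_stalk e x = [set f | local_ring x (f / c)].
Proof.
case: x => [|p pm pI|].
- by exists 1; rewrite ?oner_neq0//; apply/seteqP; split=> f.
- exists 1; rewrite ?oner_neq0//.
  by apply/seteqP; split=> f /=; rewrite divr1.
- exists ((@FracField.tofrac {poly k} 'X) ^ e) => //.
  by rewrite expfz_neq0 // tofrac_eq0 polyX_eq0.
Qed.

Lemma twist_stalkB x e (f g : K) :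
  twist_stalk e x f -> twist_stalk e x g -> twist_stalk e x (f - g).
Proof.
have [c _ ->] := twist_stalkE x e => /= fx gx; rewrite mulrBl.
have [_ B _] := local_ring_closed x.
by apply: set_mem; apply: B; apply: mem_set.
Qed.

Lemma twist_stalk0 x e : twist_stalk e x 0.
Proof.
have [c _ ->] := twist_stalkE x e => /=; rewrite mul0r.
have [o B _] := local_ring_closed x.
by apply: set_mem; rewrite -[X in X \in _](subrr 1); exact: B.
Qed.

Lemma twist_stalkM x e (a f : K) :
  local_ring x a -> twist_stalk e x f -> twist_stalk e x (a * f).
Proof.
have [c _ ->] := twist_stalkE x e => /= ax fx; rewrite -mulrA.
have [_ _ M] := local_ring_closed x.
by apply: set_mem; apply: M; apply: mem_set.
Qed.

Lemma sumO_zmod_closed U : zmod_closed (@sumO_pred U).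
Proof.
split; first by apply/asboolP; split=> // y i; exact: twist_stalk0.
move=> s t /asboolP[sc sl] /asboolP[tc tl]; apply/asboolP; split=> [y z|y i].
  by rewrite !fctE (sc y z) (tc y z).
exact: twist_stalkB (sl y i) (tl y i).
Qed.
HB.instance Definition _ U :=
  GRing.isZmodClosed.Build (U -> I -> K) (@sumO_pred U) (@sumO_zmod_closed U).

Record sumO_sec U := SumO { sumO_val : U -> I -> K; _ : sumO_val \in @sumO_pred U }.
HB.instance Definition _ U := [isSub for @sumO_val U].
HB.instance Definition _ U := [Choice of sumO_sec U by <:].
HB.instance Definition _ U := [SubChoice_isSubZmodule of sumO_sec U by <:].

Lemma sumO_scale_subproof U (a : regular U) (s : sumO_sec U) :
  (fun y i => val a y * val s y i) \in @sumO_pred U.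
Proof.
have /asboolP[ac al] := valP a; have /asboolP[sc sl] := valP s.
apply/asboolP; split=> [y z|y i]; first by rewrite (ac y z) (sc y z).
exact: twist_stalkM (al y) (sl y i).
Qed.
Definition sumO_scale U (a : regular U) (s : sumO_sec U) : sumO_sec U :=
  SumO (sumO_scale_subproof a s).

Lemma sumO_scaleA U (a b : regular U) s :
  sumO_scale a (sumO_scale b s) = sumO_scale (a * b) s.
Proof. by apply: val_inj; apply/funext => y; apply/funext => i; exact: mulrA. Qed.

Lemma sumO_scale1 U : left_id 1 (@sumO_scale U).
Proof.
by move=> s; apply: val_inj; apply/funext => y; apply/funext => i; exact: mul1r.
Qed.

Lemma sumO_scaleDr U : right_distributive (@sumO_scale U) +%R.
Proof.
move=> a s t; apply: val_inj; apply/funext => y; apply/funext => i.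
exact: mulrDr.
Qed.

Lemma sumO_scaleDl U s : {morph (@sumO_scale U)^~ s : a b / a + b}.
Proof.
move=> a b; apply: val_inj; apply/funext => y; apply/funext => i.
exact: mulrDl.
Qed.

HB.instance Definition _ U := GRing.Zmodule_isLmodule.Build (regular U)
  (sumO_sec U) (@sumO_scaleA U) (@sumO_scale1 U) (@sumO_scaleDr U) (@sumO_scaleDl U).

Lemma sumO_res_subproof U V (h : V `<=` U) (s : sumO_sec U) :
  rst h (val s) \in @sumO_pred V.
Proof.
have /asboolP[sc sl] := valP s; apply/asboolP; split=> [y z|y i].
  exact: sc.
exact: sl (incl h y) i.
Qed.
Definition sumO_res U V (h : V `<=` U) (s : sumO_sec U) : sumO_sec V :=
  SumO (sumO_res_subproof h s).

Lemma sumO_glue (J : Type) U (W : J -> opens k) (h : forall i, W i `<=` U)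
    (s : forall i, sumO_sec (W i)) : U `<=` \bigcup_i W i ->
  (forall i j V (hi : V `<=` W i) (hj : V `<=` W j),
    sumO_res hi (s i) = sumO_res hj (s j)) ->
  exists t : sumO_sec U, forall i, sumO_res (h i) t = s i.
Proof.
move=> cov st.
have ss i j (y : W i) (z : W j) : sumO_val (s i) y = sumO_val (s j) z.
  have gen (l : J) (u : W l) : opens_set (W l) Generic.
    exact: opens_generic (set_mem (valP u)).
  pose V := Opens (openI (opens_open (W i)) (opens_open (W j))).
  have hi : V `<=` W i by move=> u [].
  have hj : V `<=` W j by move=> u [].
  have VG : opens_set V Generic by split; [exact: gen y|exact: gen z].
  pose g : V := exist _ Generic (mem_set VG).
  have /asboolP[ci _] := valP (s i); have /asboolP[cj _] := valP (s j).
  rewrite (ci y (incl hi g)) (cj z (incl hj g)).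
  exact: (congr1 (fun r : sumO_sec V => sumO_val r g) (st i j V hi hj)).
have [t tE] := @rst_glue _ _ J U W h (fun i => sumO_val (s i)) cov
  (fun i j y z _ => ss i j y z).
have cv (y : U) : exists i (z : W i), y = incl (h i) z.
  have [i _ Wy] := cov _ (set_mem (valP y)).
  by exists i, (exist _ (val y) (mem_set Wy)); apply: val_inj.
have tz i (z : W i) : t (incl (h i) z) = sumO_val (s i) z.
  exact: (congr1 (@^~ z) (tE i)).
have tP : t \in @sumO_pred U.
  apply/asboolP; split=> [y z|y e].
    have [i [y' ->]] := cv y; have [j [z' ->]] := cv z.
    by rewrite !tz; exact: ss.
  have [i [y' ->]] := cv y; rewrite tz.
  by have /asboolP[_ si] := valP (s i); exact: si.
by exists (SumO tP) => i; apply: val_inj; exact: tE.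
Qed.

Definition sumO : Omod k.
Proof.
refine (@OMod k (fun U => sumO_sec U) sumO_res _ _ _ _ sumO_glue).
- by move=> U V h a s t; apply: val_inj.
- by move=> U h s; apply: val_inj; exact: rst_id.
- by move=> U V W hVU hWV hWU s; apply: val_inj; exact: rst_comp.
- move=> J U W h s t cov st; apply: val_inj.
  apply: (@rst_separated _ _ J U W h _ _ cov) => i.
  exact: (congr1 (@sumO_val (W i)) (st i)).
Defined.
End LineBundles.
Arguments sumO {k I} d.

Section Skyscraper.
Variables (k : fieldType) (x : P1 k) (r : nat).
Implicit Types U V W : opens k.
Local Notation kappa := (residue_field x).

(* kappa(x)^r if x lies in U, and 0 otherwise. *)
Definition sky_sec U := (x \in opens_set U) -> 'rV[kappa]_r.
HB.instance Definition _ U := GRing.Zmodule.on (sky_sec U).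

Definition sky_scale U (a : regular U) (s : sky_sec U) : sky_sec U :=
  fun h => residue (germ h a) *: s h.

Lemma germM U (h : x \in opens_set U) : {morph germ h : a b / a * b}.
Proof. by move=> a b; apply: val_inj. Qed.
Lemma germD U (h : x \in opens_set U) : {morph germ h : a b / a + b}.
Proof. by move=> a b; apply: val_inj. Qed.
Lemma germ1 U (h : x \in opens_set U) : germ h 1 = 1.
Proof. by apply: val_inj. Qed.

Lemma residueM : {morph @residue k x : a b / a * b}.
Proof. by move=> a b; rewrite /residue rmorphM. Qed.
Lemma residueD : {morph @residue k x : a b / a + b}.
Proof. by move=> a b; rewrite /residue rmorphD. Qed.
Lemma residue1 : @residue k x 1 = 1.
Proof. by rewrite /residue rmorph1. Qed.

Lemma sky_scaleA U (a b : regular U) s :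
  sky_scale a (sky_scale b s) = sky_scale (a * b) s.
Proof. by apply/funext => h; rewrite /sky_scale scalerA germM residueM. Qed.
Lemma sky_scale1 U : left_id 1 (@sky_scale U).
Proof. by move=> s; apply/funext => h; rewrite /sky_scale germ1 residue1 scale1r. Qed.
Lemma sky_scaleDr U : right_distributive (@sky_scale U) +%R.
Proof. by move=> a s t; apply/funext => h; exact: scalerDr. Qed.
Lemma sky_scaleDl U s : {morph (@sky_scale U)^~ s : a b / a + b}.
Proof.
move=> a b; apply/funext => h; rewrite /sky_scale germD residueD.
exact: scalerDl.
Qed.
HB.instance Definition _ U := GRing.Zmodule_isLmodule.Build (regular U)
  (sky_sec U) (@sky_scaleA U) (@sky_scale1 U) (@sky_scaleDr U) (@sky_scaleDl U).

Definition sky_res U V (h : V `<=` U) (s : sky_sec U) : sky_sec V :=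
  fun hx => s (mem_set (h _ (set_mem hx))).

Lemma sky_glue (J : Type) U (W : J -> opens k) (h : forall i, W i `<=` U)
    (s : forall i, sky_sec (W i)) : U `<=` \bigcup_i W i ->
  (forall i j V (hi : V `<=` W i) (hj : V `<=` W j),
    sky_res hi (s i) = sky_res hj (s j)) ->
  exists t : sky_sec U, forall i, sky_res (h i) t = s i.
Proof.
move=> cov st; have ex (y : x \in opens_set U) : exists i, opens_set (W i) x.
  by have [i _ Wy] := cov _ (set_mem y); exists i.
pose idx y := projT1 (cid (ex y)); have idxP y : opens_set (W (idx y)) x := projT2 (cid (ex y)).
exists (fun y => s (idx y) (mem_set (idxP y))) => i.
apply/funext => y; rewrite /sky_res; set y' := mem_set _; set z := mem_set _.
pose V := Opens (openI (opens_open (W i)) (opens_open (W (idx y')))).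
have hi : V `<=` W i by move=> u [].
have hj : V `<=` W (idx y') by move=> u [].
have Vx : x \in opens_set V by apply: mem_set; split; apply: set_mem.
have := congr1 (@^~ Vx) (st _ _ V hi hj); rewrite /sky_res.
rewrite (bool_irrelevance (mem_set (hi _ _)) y).
by rewrite (bool_irrelevance (mem_set (hj _ _)) z) => ->.
Qed.

Definition skyscraper : Omod k.
Proof.
refine (@OMod k (fun U => sky_sec U) sky_res _ _ _ _ sky_glue).
- move=> U V h a s t; apply/funext => hx; rewrite /sky_res.
  congr (residue _ *: _ + _); apply: val_inj => /=.
  by congr (val a _); apply: val_inj.
- by move=> U h s; apply/funext => hx; congr (s _); exact: bool_irrelevance.
- move=> U V W hVU hWV hWU s; apply/funext => hx.
  by congr (s _); exact: bool_irrelevance.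
- move=> J U W h s t cov st; apply/funext => hx.
  have [j _ Wx] := cov _ (set_mem hx).
  have := congr1 (@^~ (mem_set Wx)) (st j); rewrite /= /sky_res.
  by rewrite (bool_irrelevance (mem_set (h j _ _)) hx).
Defined.
End Skyscraper.

Definition hecke_modification (k : fieldType) (x : P1 k) (r : nat)
    (E' E : Omod k) :=
  exists (i : hom E' E) (p : hom E (skyscraper x r)), short_exact i p.

(* The subsheaves counted by the multiplicity m_{x,r}(E', E); the last clause
   says that E/N, the cokernel of the inclusion, is isomorphic to the
   skyscraper sheaf. *)
Definition hecke_subsheaves (k : fieldType) (x : P1 k) (r : nat)
    (E' E : Omod k) : set (subsheaf E) :=
  [set N | [/\ coherent (sheaf_of_sub N), iso (sheaf_of_sub N) E'
    & exists p : hom E (skyscraper x r), short_exact (sub_incl N) p]].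
Arguments hecke_subsheaves {k} x r E' E.

(* The number of th-dimensional subspaces of k^l, for k finite. *)
Definition card_Gr (k : fieldType) (th l : nat) : nat :=
  #|` fset_set [set L : {vspace 'rV[k]_l} | \dim L = th]|%fset.

(* Main.v *)
(* Since x has degree one, a surjection from the direct sum E of the O(d_i) onto
   the skyscraper sheaf is the same as a surjection k^n -> k^r on the fibre of E
   at x, so the subsheaves in question correspond to the subspaces H of k^n of
   codimension r. Order the indices by decreasing d_i and write H in reduced
   echelon form: H consists of the c with c_j = \sum_(i not in D) c_i N_ij for
   all j in D, where #|D| = r and N_ij <> 0 forces j to precede i, hence
   d_i <= d_j. The unipotent matrix built from N then extends to an automorphism
   of E carrying H to a coordinate subspace, so the subsheaf of H is isomorphic
   to the sum of the O(d_i - 1_D(i)).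

   The degrees of a direct sum of line bundles are determined by the sum, so the
   isomorphism class only depends on the numbers of elements of D of each degree.
   The multiplicity is therefore the sum over such D of q^inv(D), the number of
   admissible N. Inversions between indices of different degrees contribute
   alpha for every D; those within one degree add up to the cell decomposition
   of a Grassmannian. *)
Require Import Defs.
From HB Require Import structures.
From mathcomp Require Import all_boot all_order all_algebra.
From mathcomp Require Import fingroup perm.
From mathcomp Require Import generic_quotient ring_quotient.
From mathcomp Require Import finmap.
From mathcomp Require Import all_classical.
From mathcomp Require Import topology_structure.
From mathcomp Require Import zify.

Set Implicit Arguments.
Unset Strict Implicit.
Unset Printing Implicit Defensive.

Import Order.TTheory GRing.Theory Num.Theory.
Local Open Scope classical_set_scope.
Local Open Scope ring_scope.

(** * Reduced echelon forms *)

Section Echelon.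
Variables (k : fieldType) (I : finType) (rho : I -> nat).
Implicit Types (H : set (I -> k)) (D : {set I}) (N : I -> I -> k).

(** Echelon forms are used because an arbitrary automorphism of the fibre does not extend to E: an
    entry from the i-th to the j-th summand has to be the value at x of a global section of O(d_j -
    d_i). Nonzero sections exist only for d_i <= d_j, which is what the entries of an echelon form
    satisfy, and with generators [u] of the line bundles near x the quotient u(d_j) / u(d_i) is such
    a section. Ties between equal degrees are broken to make the order total, so that the pair (D,
    N) is unique and counting subsheaves becomes counting pairs. No quotient sheaf is formed: a
    modification is recognised through the kernel of its map to the skyscraper sheaf. Finite
    rational points and infinity are treated at once through a local frame. Grassmannians are
    counted by the same echelon forms, with the order reversed, since [card_Gr] prescribes a
    dimension whereas the size of D is a codimension. *)

Definition linear_set H :=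
  H (fun=> 0) /\ forall a c c', H c -> H c' -> H (fun i => a * c i + c' i).

Definition graph D N : set (I -> k) :=
  [set c | forall j, j \in D -> c j = \sum_(i | i \notin D) c i * N i j].

Definition echelon D N :=
  forall i j, N i j != 0 -> [/\ i \notin D, j \in D & (rho j < rho i)%N].

Lemma linear_set_sum H (J : finType) (P : pred J) (c : J -> I -> k) a :
  linear_set H -> (forall j, P j -> H (c j)) ->
  H (fun i => \sum_(j | P j) a j * c j i).
Proof.
move=> [H0 HD] Hc.
have E : (fun i => \sum_(j | P j) a j * c j i) =
   \sum_(j | P j) (fun i => a j * c j i) by apply/funext => i; rewrite fct_sumE.
rewrite E.
elim/big_rec: _ => [|j y Pj Hy]; first exact: H0.
exact: HD (Hc _ Pj) Hy.
Qed.

Lemma linear_graph D N : linear_set (graph D N).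
Proof.
split=> [j jD|a c c' Hc Hc' j jD]; first by rewrite big1// => i _; rewrite mul0r.
rewrite (Hc j jD) (Hc' j jD) mulr_sumr -big_split/=.
by apply: eq_bigr => i _; rewrite mulrDl mulrA.
Qed.

(* The complement of D consists of the leading positions of the elements of H,
   the leading position being the last one for rho. *)
Lemma echelon_exists H : injective rho -> linear_set H ->
  exists D N, echelon D N /\ H = graph D N.
Proof.
move=> rho_inj lH; have [H0 HD] := lH.
have HZ a c : H c -> H (fun i => a * c i).
  move=> Hc; have := HD a c _ Hc H0.
  by congr H; apply/funext => i; rewrite addr0.
have HB c c' : H c -> H c' -> H (fun i => c i - c' i).
  move=> Hc Hc'; have := HD (-1) c' c Hc' Hc.
  by congr H; apply/funext => i; rewrite mulN1r addrC.
pose D := [set i | ~~ `[< exists v, [/\ H v, v i != 0 &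
   forall j, (rho i < rho j)%N -> v j = 0] >]]%SET.
have inD i v : H v -> v i != 0 -> (forall j, (rho i < rho j)%N -> v j = 0) ->
    i \notin D.
  by move=> Hv vi vj; rewrite inE negbK; apply/asboolP; exists v.
(* The rows of the reduced form: leading coordinate 1 at i, and 0 at every other leading
   position. *)
pose red i h := [/\ H h, h i = 1, (forall j, (rho i < rho j)%N -> h j = 0) &
   forall j, j \notin D -> j != i -> h j = 0].
have redP n : forall i, i \notin D -> (rho i < n)%N -> exists h, red i h.
  elim: n => // n IH i iD; rewrite ltnS => rin.
  have : forall j, exists h, j \notin D -> (rho j < rho i)%N -> red j h.
    move=> j; have [jD|jD] := boolP (j \in D); first by exists (fun=> 0).
    have [ji|_] := ltnP (rho j) (rho i); last by exists (fun=> 0).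
    by have [h hr] := IH j jD (leq_trans ji rin); exists h.
  move=> /choice[h hP].
  have := iD; rewrite inE negbK => /asboolP[v [Hv vi vj]].
  (* A vector with leading position i is normalised, then cleared at the smaller leading positions
     by the reduced vectors already built. *)
  pose w j := (v i)^-1 * v j.
  exists (fun l => w l - \sum_(j | (j \notin D) && (rho j < rho i)%N) w j * h j l).
  split.
  - apply: HB; first exact: HZ.
    apply: linear_set_sum => // j /andP[jD ji].
    by have [] := hP j jD ji.
  - rewrite big1 ?subr0 /w ?mulVf// => j /andP[jD ji].
    by have [_ _ -> //] := hP j jD ji; rewrite ?mulr0.
  - move=> l il; rewrite /w (vj l)// mulr0 big1 ?subr0// => j /andP[jD ji].
    have [_ _ -> //] := hP j jD ji; rewrite ?mulr0//.
    exact: ltn_trans il.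
  move=> l lD li; case: (ltngtP (rho l) (rho i)) => [lti|il|/rho_inj E].
  - rewrite (bigD1 l) ?lD//= big1 ?addr0 => [|j /andP[/andP[jD ji] jl]].
      by have [_ -> _ _] := hP l lD lti; rewrite mulr1 subrr.
    by have [_ _ _ -> //] := hP j jD ji; rewrite ?mulr0// eq_sym.
  - rewrite {1}/w (vj l)// mulr0 big1 ?subr0// => j /andP[jD ji].
    have [_ _ -> //] := hP j jD ji; rewrite ?mulr0//.
    exact: ltn_trans il.
  - by rewrite E eqxx in li.
have : forall i, exists h, i \notin D -> red i h.
  move=> i; have [iD|iD] := boolP (i \in D); first by exists (fun=> 0).
  by have [h hr] := redP (rho i).+1 i iD (leqnn _); exists h.
move=> /choice[h hP].
pose N i j := if (i \notin D) && (j \in D) then h i j else 0.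
have Hsum c : H c <-> c = (fun l => \sum_(i | i \notin D) c i * h i l).
  split=> [Hc|->]; last first.
    by apply: linear_set_sum => // i iD; have [] := hP i iD.
  set s := fun l => _.
  have Hs : H s by apply: linear_set_sum => // i iD; have [] := hP i iD.
  (* The remainder vanishes at all leading positions; if it were nonzero, its own leading position
     would contradict this. *)
  pose w l := c l - s l; have Hw : H w by exact: HB.
  have w0 l : l \notin D -> w l = 0.
    move=> lD; rewrite /w /s (bigD1 l)//= big1 ?addr0 => [|j /andP[jD jl]].
      by have [_ -> _ _] := hP l lD; rewrite mulr1 subrr.
    by have [_ _ _ -> //] := hP j jD; rewrite ?mulr0// eq_sym.
  apply/funext => l; apply/eqP; rewrite -subr_eq0 -/(w l).
  apply/negPn/negP => wl.
  have [j wj jmax] := @arg_maxnP _ l (fun j => w j != 0) rho wl.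
  have /w0 w0j : j \notin D.
    apply: (inD j w) => // j' jj'; apply/eqP/negPn/negP => /jmax.
    by rewrite /= leqNgt jj'.
  by move: wj; rewrite /= w0j eqxx.
exists D, N; split.
  move=> i j; rewrite /N; case: ifP => [/andP[iD jD] hij|]; last by rewrite eqxx.
  split=> //; have [_ _ h0 _] := hP i iD.
  rewrite ltnNge leq_eqVlt negb_or; apply/andP; split.
    by apply/eqP => /rho_inj E; move: iD; rewrite E jD.
  by apply: contraNN hij => /h0 ->.
apply/seteqP; split=> c.
  move=> /Hsum cE j jD; rewrite {1}cE; apply: eq_bigr => i iD.
  by rewrite /N iD jD.
move=> Hc; apply/Hsum/funext => l.
have [lD|lD] := boolP (l \in D).
  by rewrite (Hc l lD); apply: eq_bigr => i iD; rewrite /N iD lD.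
rewrite (bigD1 l)//= big1 ?addr0 => [|j /andP[jD jl]].
  by have [_ -> _ _] := hP l lD; rewrite mulr1.
by have [_ _ _ -> //] := hP j jD; rewrite ?mulr0// eq_sym.
Qed.

(** The coordinates outside D are free; taking a unit vector there produces the rows of the echelon
    form. *)
Lemma graph_row D N i : echelon D N -> i \notin D ->
  graph D N (fun j => (i == j)%:R + N i j).
Proof.
move=> eN iD j jD; rewrite (bigD1 i)//= big1 => [|l /andP[lD li]].
  rewrite eqxx addr0 (_ : i == j = false).
    rewrite add0r (_ : N i i = 0) ?addr0 ?mul1r//.
    by apply/eqP/negPn/negP => /eN[_]; rewrite (negbTE iD).
  by apply: contraNF iD => /eqP ->.
rewrite eq_sym (negbTE li) add0r (_ : N i l = 0) ?mul0r//.
by apply/eqP/negPn/negP => /eN[_]; rewrite (negbTE lD).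
Qed.

(** The row of i in the first form is nonzero only at i and at positions of smaller [rho]. If i lay
    in the set D of the second form, that form would express the entry 1 at i through entries at
    positions of larger [rho], all of them 0. Once the sets agree, N is read off from the rows. *)
Lemma graph_inj D N D' N' : echelon D N -> echelon D' N' ->
  graph D N = graph D' N' -> D = D' /\ N = N'.
Proof.
have sub D1 N1 D2 N2 i : echelon D1 N1 -> echelon D2 N2 ->
    graph D1 N1 = graph D2 N2 -> i \notin D1 -> i \notin D2.
  move=> e1 e2 E iD1; apply/negP => iD2.
  have := graph_row e1 iD1; rewrite E => /(_ i iD2).
  have N0 : N1 i i = 0 by apply/eqP/negPn/negP => /e1[_]; rewrite (negbTE iD1).
  rewrite eqxx N0 addr0 big1 => [/eqP|j jD2]; first by rewrite oner_eq0.
  have [->|N2j] := eqVneq (N2 j i) 0; first by rewrite mulr0.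
  have [_ _ lij] := e2 _ _ N2j.
  rewrite (_ : i == j = false) ?add0r; last by apply: contraNF jD2 => /eqP <-.
  have [->|/e1[_ _]] := eqVneq (N1 i j) 0; first by rewrite mul0r.
  by rewrite ltnNge (ltnW lij).
move=> e1 e2 E.
have DE : D = D'.
  apply/setP => i; apply/negb_inj; apply/idP/idP; first exact: sub E.
  exact: sub (esym E).
split=> //; rewrite -{}DE in E e2 *; apply/funext => i; apply/funext => j.
have [iD|iD] := boolP (i \in D).
  have -> : N i j = 0 by apply/eqP/negPn/negP => /e1[]; rewrite iD.
  by have -> : N' i j = 0 by apply/eqP/negPn/negP => /e2[]; rewrite iD.
have [jD|jD] := boolP (j \in D); last first.
  have -> : N i j = 0 by apply/eqP/negPn/negP => /e1[_]; rewrite (negbTE jD).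
  by have -> : N' i j = 0 by apply/eqP/negPn/negP => /e2[_]; rewrite (negbTE jD).
have := graph_row e1 iD; rewrite E => /(_ j jD).
rewrite (_ : i == j = false) ?add0r; last by apply: contraNF iD => /eqP ->.
move=> ->; rewrite (bigD1 i)//= big1 => [|l /andP[lD li]].
  rewrite eqxx addr0 (_ : N i i = 0) ?addr0 ?mul1r//.
  by apply/eqP/negPn/negP => /e1[_]; rewrite (negbTE iD).
rewrite eq_sym (negbTE li) add0r (_ : N i l = 0) ?mul0r//.
by apply/eqP/negPn/negP => /e1[_]; rewrite (negbTE lD).
Qed.

End Echelon.

(** * Values of rational functions at a point *)

Section LocalRing.
Variable k : fieldType.
Local Notation K := {fraction {poly k}}.
Local Notation "a %:F" := (@FracField.tofrac {poly k} a).
Implicit Types (x y : P1 k) (f g : K).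

Lemma local_ringB y f g : local_ring y f -> local_ring y g -> local_ring y (f - g).
Proof.
by have [_ B _] := local_ring_closed y => /mem_set hf /mem_set hg; exact/set_mem/B.
Qed.

Lemma local_ringM y f g : local_ring y f -> local_ring y g -> local_ring y (f * g).
Proof.
by have [_ _ M] := local_ring_closed y => /mem_set hf /mem_set hg; exact/set_mem/M.
Qed.

Lemma local_ring1 y : local_ring y 1.
Proof. by have [/set_mem] := local_ring_closed y. Qed.

Lemma local_ring0 y : local_ring y 0.
Proof. by rewrite -(subrr 1); apply: local_ringB; exact: local_ring1. Qed.

Lemma local_ringD y f g : local_ring y f -> local_ring y g -> local_ring y (f + g).
Proof.
move=> hf hg; rewrite -[g]opprK; apply: local_ringB => //; rewrite -sub0r.
exact: local_ringB (local_ring0 y) hg.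
Qed.

Lemma local_ringX y f n : local_ring y f -> local_ring y (f ^+ n).
Proof.
move=> hf; elim: n => [|n IH]; first by rewrite expr0; exact: local_ring1.
by rewrite exprS; exact: local_ringM.
Qed.

Lemma local_ring_sum y (J : finType) (P : pred J) (F : J -> K) :
  (forall j, P j -> local_ring y (F j)) -> local_ring y (\sum_(j | P j) F j).
Proof.
move=> h; elim/big_rec: _ => [|j z Pj Hz]; first exact: local_ring0.
by apply: local_ringD => //; exact: h.
Qed.

Definition germ_const x (c : k) : residue_field x := residue (const_stalk x c).

Lemma residueP x (f g : stalk x) : residue f = residue g <-> f - g \in @max_ideal k x.
Proof.
rewrite /residue; split.
  by move=> /eqP; rewrite -Quotient.idealrBE.
by rewrite Quotient.idealrBE => /eqP.
Qed.

Lemma germ_constD x : {morph @germ_const x : a b / a + b}.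
Proof.
move=> a b; rewrite /germ_const -residueD; congr residue.
by apply: val_inj; rewrite /= polyCD tofracD.
Qed.

Lemma germ_constM x : {morph @germ_const x : a b / a * b}.
Proof.
move=> a b; rewrite /germ_const -residueM; congr residue.
by apply: val_inj; rewrite /= polyCM tofracM.
Qed.

Lemma germ_const1 x : germ_const x 1 = 1.
Proof.
rewrite /germ_const -(residue1 x); congr residue.
by apply: val_inj; rewrite /= polyC1 tofrac1.
Qed.

Lemma germ_const0 x : germ_const x 0 = 0.
Proof. by apply: (addIr (germ_const x 0)); rewrite -germ_constD !add0r. Qed.

Lemma germ_constN x a : germ_const x (- a) = - germ_const x a.
Proof. by apply: (addIr (germ_const x a)); rewrite -germ_constD !addNr germ_const0. Qed.

Lemma germ_const_inj x : injective (@germ_const x).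
Proof.
move=> a b E; apply/eqP; rewrite -subr_eq0; apply/negPn/negP => ab.
have : germ_const x ((a - b)^-1 * (a - b)) = 0.
  by rewrite germ_constM germ_constD germ_constN E subrr mulr0.
by rewrite mulVf// germ_const1 => /eqP; rewrite oner_eq0.
Qed.

(** The basis vector e of the residue field is itself a constant: 1 = c0 e for a constant c0, which
    is then invertible. *)
Lemma germ_const_surj x : degree x 1 -> forall u, exists c, u = germ_const x c.
Proof.
move=> [e eP].
have ex u : exists c, u = germ_const x c * e ord0.
  by have [c [-> _]] := eP u; exists (c ord0); rewrite big_ord1.
have [c0 c0E] := ex 1.
have c00 : c0 != 0.
  by apply/eqP => c00; move: c0E; rewrite c00 germ_const0 mul0r => /eqP; rewrite oner_eq0.
move=> u; have [c ->] := ex u; exists (c / c0).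
have : germ_const x c0^-1 * (germ_const x c0 * e ord0) = germ_const x c0^-1.
  by rewrite -c0E mulr1.
by rewrite mulrA -germ_constM mulVf// germ_const1 mul1r => ->; rewrite germ_constM.
Qed.

(* The value of f at a point x of degree one; 0 if f is not regular at x. *)
Definition ev x f : k :=
  xget 0 [set c | exists2 g : stalk x, stalk_val g = f & residue g = germ_const x c].

Section Ev.
Variables (x : P1 k) (hdeg : degree x 1).

Lemma ev_residue (g : stalk x) : germ_const x (ev x (stalk_val g)) = residue g.
Proof.
rewrite /ev; case: xgetP => [c _ [g' /val_inj -> //]|no].
have [c cE] := germ_const_surj hdeg (residue g).
by case: (no c); exists g.
Qed.

Lemma ev_residueS f (h : local_ring x f) :
  germ_const x (ev x f) = residue (Stalk (mem_set h)).
Proof. exact: (ev_residue (Stalk (mem_set h))). Qed.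

Lemma evB f g : local_ring x f -> local_ring x g -> ev x (f - g) = ev x f - ev x g.
Proof.
move=> hf hg; apply: (@germ_const_inj x); rewrite germ_constD germ_constN.
rewrite (ev_residueS hf) (ev_residueS hg) (ev_residueS (local_ringB hf hg)).
apply/eqP; rewrite -(inj_eq (addIr (residue (Stalk (mem_set hg))))) subrK.
by rewrite -residueD; apply/eqP; congr residue; apply: val_inj; rewrite /= subrK.
Qed.

Lemma evM f g : local_ring x f -> local_ring x g -> ev x (f * g) = ev x f * ev x g.
Proof.
move=> hf hg; apply: (@germ_const_inj x); rewrite germ_constM.
rewrite (ev_residueS hf) (ev_residueS hg) (ev_residueS (local_ringM hf hg)).
by rewrite -residueM; congr residue; apply: val_inj.
Qed.

Lemma evC c : ev x c%:P%:F = c.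
Proof.
apply: (@germ_const_inj x); rewrite (ev_residueS (local_ring_const x c)).
by congr residue; apply: val_inj.
Qed.

Lemma ev0 : ev x 0 = 0.
Proof. by rewrite -[RHS]evC polyC0 tofrac0. Qed.

Lemma evD f g : local_ring x f -> local_ring x g -> ev x (f + g) = ev x f + ev x g.
Proof.
move=> hf hg; rewrite -[g in LHS]opprK.
have hN : local_ring x (- g) by rewrite -sub0r; exact: local_ringB (local_ring0 x) hg.
by rewrite evB// -[- g]sub0r evB ?ev0 ?sub0r ?opprK//; exact: local_ring0.
Qed.

Lemma ev_sum (J : finType) (P : pred J) (F : J -> K) :
  (forall j, P j -> local_ring x (F j)) ->
  ev x (\sum_(j | P j) F j) = \sum_(j | P j) ev x (F j).
Proof.
move=> h; suff [] : local_ring x (\sum_(j | P j) F j) /\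
  ev x (\sum_(j | P j) F j) = \sum_(j | P j) ev x (F j) by [].
elim/big_rec2: _ => [|j z w Pj [Hz Hw]]; first by rewrite ev0; split=> //; exact: local_ring0.
by rewrite evD ?Hw//; [split=> //; apply: local_ringD => //|]; exact: h.
Qed.

(** The maximal ideal is defined as the set of non-units, so vanishing at x becomes
    non-invertibility, which can be tested on numerators and denominators. *)
Lemma ev_eq0 f : local_ring x f ->
  ev x f = 0 <-> ~ exists2 g, local_ring x g & f * g = 1.
Proof.
move=> hf; set F := Stalk (mem_set hf).
have -> : ev x f = 0 <-> residue F = residue 0.
  rewrite -ev_residueS (_ : residue 0 = germ_const x 0).
    by split=> [->//|/germ_const_inj].
  by rewrite /germ_const; congr residue; apply: val_inj; rewrite /= polyC0 tofrac0.
split=> [/residueP|no]; last first.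
  apply/residueP/asboolP => -[g gE]; apply: no; exists (stalk_val g).
    exact: set_mem (valP g).
  by have := congr1 (@stalk_val k x) gE; rewrite subr0.
rewrite subr0 => /asboolP nu [g hg gE]; apply: nu; exists (Stalk (mem_set hg)).
exact: val_inj.
Qed.

End Ev.
End LocalRing.

(** * Generators of O(d) near a point of degree one, and a section of O(1) vanishing there *)

Section LocalFrame.
Variable k : fieldType.
Local Notation K := {fraction {poly k}}.
Local Notation "a %:F" := (@FracField.tofrac {poly k} a).
Implicit Types (x y : P1 k) (f g : K).

Lemma local_ring_unit y f c : c != 0 -> local_ring y c -> local_ring y c^-1 ->
  local_ring y f <-> local_ring y (f * c).
Proof.
move=> c0 hc hc'; split=> h; first exact: local_ringM.
by rewrite -(mulfK c0 f); exact: local_ringM.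
Qed.

Lemma tofrac_div_eq (a b c d : {poly k}) : b != 0 -> d != 0 ->
  a%:F / b%:F = c%:F / d%:F -> a * d = c * b.
Proof.
move=> b0 d0 /eqP; rewrite eqr_div ?tofrac_eq0// -!tofracM tofrac_eq => /eqP ->.
by [].
Qed.

Lemma local_ring_poly y (a : {poly k}) : y <> Infinity -> local_ring y a%:F.
Proof.
case: y => [|p pm pI|]// _; exists a, 1; split; last by rewrite tofrac1 divr1.
by rewrite dvdp1 neq_ltn pI.1 orbT.
Qed.

Lemma local_ring_polyV p pm pI (a : {poly k}) :
  ~~ (p %| a) -> local_ring (@Defs.Finite k p pm pI) (a%:F)^-1.
Proof. by move=> pa; exists 1, a; split=> //; rewrite tofrac1 div1r. Qed.

Lemma FiniteE p pm pI q qm qI :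
  p = q -> @Defs.Finite k p pm pI = @Defs.Finite k q qm qI.
Proof.
move=> E; subst q; congr Defs.Finite; first exact: bool_irrelevance.
exact: Prop_irrelevance.
Qed.

Lemma irreducible_dvd_monic (p q : {poly k}) : p \is monic ->
  irreducible_poly p -> q \is monic -> irreducible_poly q -> p %| q -> p = q.
Proof.
move=> pm pI qm qI pq; apply/eqP; rewrite -eqp_monic//; apply: qI.2 => //.
by rewrite neq_ltn pI.1 orbT.
Qed.

Lemma open_P1D1 (z : P1 k) : z <> Generic -> open [set y | y <> z].
Proof.
move=> zG; right; split; first by move=> E; exact: zG.
rewrite (_ : ~` _ = [set z]); first exact: finite_set1.
by apply/seteqP; split=> y /=; [move=> /contrapT|move=> ->; exact].
Qed.

Lemma infty_neq_Generic : Infinity <> Generic :> P1 k.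
Proof. by []. Qed.

Definition opensD1 (z : P1 k) (zG : z <> Generic) : opens k := Opens (open_P1D1 zG).

Definition point (a : k) : P1 k :=
  Defs.Finite (monicXsubC a) (irredp_XsubC a).

Lemma local_ring_XsubCV y a : y <> point a -> y <> Infinity ->
  local_ring y ('X - a%:P)%:F^-1.
Proof.
case: y => [|p pm pI|]// ya _; apply: local_ring_polyV; apply/negP => pa.
apply: ya; apply: FiniteE; apply: irreducible_dvd_monic pa => //.
  exact: monicXsubC.
exact: irredp_XsubC.
Qed.

Lemma tofracX_neq0 : ('X : {poly k})%:F != 0.
Proof. by rewrite tofrac_eq0 polyX_eq0. Qed.

Lemma tofracXsubC_neq0 a : ('X - a%:P : {poly k})%:F != 0.
Proof. by rewrite tofrac_eq0 polyXsubC_eq0. Qed.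

Lemma local_ring_infty_XsubC a : local_ring Infinity (('X - a%:P)%:F / 'X%:F).
Proof. by exists ('X - a%:P), 'X; rewrite polyX_eq0 size_polyX size_XsubC. Qed.

Lemma local_ring_infty_XsubCV a : local_ring Infinity ('X%:F / ('X - a%:P)%:F).
Proof. by exists 'X, ('X - a%:P); rewrite polyXsubC_eq0 size_polyX size_XsubC. Qed.

Lemma local_ring_inftyXV n : local_ring (Infinity : P1 k) ('X%:F ^- n).
Proof.
rewrite -exprVn -div1r -tofrac1; apply: local_ringX.
by exists 1, 'X; rewrite polyX_eq0 size_polyX size_poly1.
Qed.

Lemma local_ring_inftyX : ~ local_ring (Infinity : P1 k) 'X%:F.
Proof.
move=> [a [b [b0 ab E]]].
have := @tofrac_div_eq 'X 1 a b (oner_neq0 _) b0.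
rewrite tofrac1 divr1 => /(_ E); rewrite mulr1 mulrC => XE; move: ab.
by rewrite -XE size_mulX// ltnn.
Qed.

(** A fraction whose denominator does not vanish at a is a unit unless X - a divides its
    numerator. *)
Lemma ev_eq0_point a (hdeg : degree (point a) 1) f : local_ring (point a) f ->
  ev (point a) f = 0 <-> local_ring (point a) (f / ('X - a%:P)%:F).
Proof.
move=> hf; rewrite (ev_eq0 hdeg hf); split.
  case: hf => n [m [pm ->]] nu; have m0 : m != 0 by apply: contraNneq pm => ->; rewrite dvdp0.
  have [pn|pn] := boolP ('X - a%:P %| n); last first.
    have n0 : n != 0 by apply: contraNneq pn => ->; rewrite dvdp0.
    case: nu; exists (m%:F / n%:F); first by exists m, n.
    by rewrite mulf_div [X in _ / X]mulrC divff// -tofracM tofrac_eq0 mulf_neq0.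
  exists (n %/ ('X - a%:P)), m; split=> //.
  rewrite -{1}(divpK pn) tofracM [LHS]mulrAC.
  by rewrite mulfK// tofracXsubC_neq0.
move=> hg [h hh E].
have [c [d [pd E']]] : local_ring (point a) ('X - a%:P)%:F^-1.
  rewrite -[_^-1]mulr1 -E mulrCA mulrA; exact: local_ringM.
have d0 : d != 0 by apply: contraNneq pd => ->; rewrite dvdp0.
have := @tofrac_div_eq 1 ('X - a%:P) c d _ d0; rewrite polyXsubC_eq0.
by rewrite tofrac1 div1r mul1r => /(_ isT E') dE; rewrite dE dvdp_mull in pd.
Qed.

(** At infinity the units are the fractions whose numerator and denominator have equal degree. A
    non-unit has a strictly smaller numerator, which leaves room for one factor X. *)
Lemma ev_eq0_infty (hdeg : degree (Infinity : P1 k) 1) f :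
  local_ring Infinity f ->
  ev Infinity f = 0 <-> local_ring Infinity (f * 'X%:F).
Proof.
move=> hf; rewrite (ev_eq0 hdeg hf); split.
  case: hf => n [m [m0 nm ->]] nu; have [lnm|mn] := ltnP (size n) (size m).
    exists (n * 'X), m; rewrite tofracM mulrAC; split=> //.
    have [->|n0] := eqVneq n 0; first by rewrite mul0r size_poly0.
    by rewrite size_mulX.
  have n0 : n != 0 by rewrite -size_poly_gt0 (leq_trans _ mn)// size_poly_gt0.
  case: nu; exists (m%:F / n%:F); first by exists m, n.
  by rewrite mulf_div [X in _ / X]mulrC divff// -tofracM tofrac_eq0 mulf_neq0.
move=> hg [h hh E]; apply: local_ring_inftyX.
rewrite -['X%:F]mul1r -E mulrAC; exact: local_ringM.
Qed.

(* u d generates O(d) at every point of U0, and division by pi identifies the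
   sections of O(d) vanishing at x with those of O(d - 1). *)
Record local_frame x (u : int -> K) (pi : K) (U0 : opens k) : Prop := LocalFrame {
  frame_neq0 : forall d, u d != 0;
  unif_neq0 : pi != 0;
  frame_in : opens_set U0 x;
  frame_twist : forall d y f, opens_set U0 y ->
    twist_stalk d y f <-> local_ring y (f / u d);
  frame_mono : forall d e y f, d <= e ->
    twist_stalk d y f -> twist_stalk e y (f * (u e / u d));
  unif_off : forall d y f, y <> x ->
    twist_stalk d y f <-> twist_stalk (d - 1) y (f / pi);
  unif_mul : forall d f, twist_stalk (d - 1) x f -> twist_stalk d x (f * pi);
  unif_ev : forall d f, local_ring x f ->
    ev x f = 0 <-> twist_stalk (d - 1) x (f * u d / pi) }.

Lemma twist_stalk_finite y d f : y <> Infinity ->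
  twist_stalk d y f = local_ring y f.
Proof. by case: y. Qed.

Lemma twist_stalk_infty d f :
  twist_stalk d Infinity f = local_ring Infinity (f / 'X%:F ^ d).
Proof. by []. Qed.

Lemma local_ring_unitz y (c : K) (d : int) : local_ring y c -> local_ring y c^-1 ->
  local_ring y (c ^ d).
Proof.
move=> hc hc'; case: d => n; first exact: local_ringX.
by rewrite NegzE -exprnN -exprVn; exact: local_ringX.
Qed.

Lemma point_neq_Generic a : point a <> Generic.
Proof. by []. Qed.

(** The coordinate X is a unit at every point other than 0 and infinity, so dividing by its powers
    changes nothing there. *)
Lemma twist_stalk_infty_frame d y f : y <> point 0 ->
  twist_stalk d y f <-> local_ring y (f / 'X%:F ^ d).
Proof.
have X0 := tofracX_neq0 => y0; case: (pselect (y = Infinity)) => [->//|yI].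
have hX : local_ring y 'X%:F by exact: local_ring_poly.
have hXV : local_ring y 'X%:F^-1.
  have -> : 'X%:F = ('X - 0%:P : {poly k})%:F by rewrite polyC0 subr0.
  exact: local_ring_XsubCV.
rewrite twist_stalk_finite//; apply: local_ring_unit.
- exact: invr_neq0 (expfz_neq0 d X0).
- by rewrite invr_expz; exact: local_ring_unitz.
- by rewrite invrK; exact: local_ring_unitz.
Qed.

Lemma local_frame_exists x : closed [set x] -> degree x 1 ->
  exists u pi U0, local_frame x u pi U0.
Proof.
have X0 := tofracX_neq0.
have le_exp (d e : int) : d <= e -> exists n : nat, e = d + n%:Z.
  by move=> de; exists `|e - d|%N; rewrite gez0_abs ?subr_ge0// [RHS]addrC subrK.
case: x => [|p pm pI|] cx hdeg.
- have /closed_openC := cx; case=> [E|[] nG _]; last by case: nG.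
  by have : (~` [set Generic]) (Infinity : P1 k) by []; rewrite E.
(* With a the value of t at x, the polynomial t - a is not a unit at x; hence p divides it, and both
   are monic irreducible. *)
- have [a pE] : exists a, p = 'X - a%:P.
    have hX : local_ring (Defs.Finite pm pI) 'X%:F by exact: local_ring_poly.
    exists (ev (Defs.Finite pm pI) 'X%:F); set a := ev _ _.
    have hXa : local_ring (Defs.Finite pm pI) ('X - a%:P)%:F by exact: local_ring_poly.
    have : ev (Defs.Finite pm pI) ('X - a%:P)%:F = 0.
      rewrite tofracB evB//; first by rewrite evC// subrr.
      exact: local_ring_const.
    move/(ev_eq0 hdeg hXa) => nu; apply: irreducible_dvd_monic => //.
    + exact: monicXsubC.
    + exact: irredp_XsubC.
    apply/negPn/negP => pX; apply: nu; exists ('X - a%:P)%:F^-1.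
      exact: local_ring_polyV.
    by apply: divff; exact: tofracXsubC_neq0.
  have E : Defs.Finite pm pI = point a by exact: FiniteE.
  rewrite {}E in hdeg cx *.
  (* For a finite point a: X0^d generates O(d) off infinity and is written 1, and [pi] is the
     section X1 - a X0 of O(1), whose only zero is a. *)
  exists (fun=> 1), ('X - a%:P)%:F, (opensD1 infty_neq_Generic); split.
  + by move=> _; exact: oner_neq0.
  + exact: tofracXsubC_neq0.
  + by [].
  + by move=> d y f yi; rewrite twist_stalk_finite// divr1.
  + move=> d e y f /le_exp[n ->]; rewrite divr1 mulr1; case: y => //.
    rewrite !twist_stalk_infty expfzDr// invfM mulrA => h; apply: local_ringM => //.
    exact: local_ring_inftyXV.
  + move=> d y f yx; have [yi|yi] := pselect (y = Infinity).
      rewrite yi !twist_stalk_infty (_ : f / _ / _ = f / 'X%:F ^ d * ('X%:F / ('X - a%:P)%:F)).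
        apply: local_ring_unit.
          exact: mulf_neq0 X0 (invr_neq0 (tofracXsubC_neq0 a)).
          exact: local_ring_infty_XsubCV.
        by rewrite invf_div; exact: local_ring_infty_XsubC.
      rewrite expfzDr// invfM exprN1 invrK.
      by rewrite -!mulrA; congr (_ * _); rewrite mulrC mulrA.
    rewrite !twist_stalk_finite//; apply: local_ring_unit.
    * by apply: invr_neq0; exact: tofracXsubC_neq0.
    * exact: local_ring_XsubCV.
    * by rewrite invrK; exact: local_ring_poly.
  + by move=> d f hf; apply: local_ringM => //; exact: local_ring_poly.
  + by move=> d f hf; rewrite mulr1; exact: ev_eq0_point.
(* At infinity: X1^d generates O(d) off t = 0 and is written t^d, and [pi] is the section X0 of
   O(1), written 1, whose only zero is infinity. *)
- exists (fun d => 'X%:F ^ d), 1, (opensD1 (@point_neq_Generic 0)); split.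
  + by move=> d; exact: expfz_neq0.
  + exact: oner_neq0.
  + by [].
  + exact: twist_stalk_infty_frame.
  + move=> d e y f /le_exp[n ->].
    have [->|yi] := pselect (y = Infinity).
      by rewrite !twist_stalk_infty -mulrA [_ / _ / _]mulrAC divff ?mul1r; last exact: expfz_neq0.
    rewrite !twist_stalk_finite// => hf; apply: local_ringM => //.
    rewrite (expfzDr _ _ X0) mulrAC divff ?mul1r; last exact: expfz_neq0.
    by apply: local_ringX; exact: local_ring_poly.
  + by move=> d y f yx; rewrite divr1; case: y yx.
  + move=> d f; rewrite !twist_stalk_infty mulr1 => hf.
    rewrite -(subrK 1 d) (expfzDr _ _ X0) expr1z invfM mulrA.
    apply: local_ringM => //; exact: (local_ring_inftyXV 1).
  + move=> d f hf; rewrite twist_stalk_infty divr1 (ev_eq0_infty hdeg hf).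
    rewrite (expfzDr _ _ X0) invfM mulrA mulfK; last exact: expfz_neq0.
    by rewrite exprN1 invrK.
Qed.

End LocalFrame.

(** * Morphisms of sheaves *)

Section Sheaf.
Variable k : fieldType.
Implicit Types F G H : Omod k.

Definition mk_linear (R : pzRingType) (A B : lmodType R) (f : A -> B)
  (Hf : linear f) : {linear A -> B} :=
  HB.pack_for {linear A -> B} f (GRing.isLinear.Build R A B *:%R f Hf).

Lemma hom_comp F G H (f : Defs.hom F G) (g : Defs.hom G H) :
  exists h : Defs.hom F H, forall U s, h U s = g U (f U s).
Proof.
have lin U : linear (fun s => g U (f U s)) by move=> a s t; rewrite !linearP.
unshelve eexists (@Defs.Hom k F H (fun U => mk_linear (lin U)) _); first last.
  by [].
by move=> U V h s /=; rewrite !hom_res.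
Qed.

Lemma iso_inv F G : iso F G -> exists (f : Defs.hom F G) (g : Defs.hom G F),
  (forall U, cancel (f U) (g U)) /\ (forall U, cancel (g U) (f U)).
Proof.
move=> [f fbij].
have ex U : exists g : G U -> F U, cancel (f U) g /\ cancel g (f U).
  by have [g gf fg] := fbij U; exists g.
pose g U := projT1 (cid (ex U)).
have gP U : cancel (f U) (g U) /\ cancel (g U) (f U) := projT2 (cid (ex U)).
have lin U : linear (g U).
  move=> a s t; have [gf fg] := gP U; apply: (can_inj gf).
  by rewrite linearP !fg.
exists f; unshelve eexists (@Defs.Hom k G F (fun U => mk_linear (lin U)) _); first last.
  by split=> U; [exact: (gP U).1|exact: (gP U).2].
move=> U V h s /=; have [gf fg] := gP U; have [gf' fg'] := gP V.
by apply: (can_inj gf'); rewrite fg' hom_res fg.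
Qed.

Lemma iso_sym F G : iso F G -> iso G F.
Proof.
move=> /iso_inv[f [g [fg gf]]]; exists g; move=> U.
by exists (f U); [exact: gf|exact: fg].
Qed.

Lemma iso_trans F G H : iso F G -> iso G H -> iso F H.
Proof.
move=> [f fb] [g gb]; have [h hE] := hom_comp f g; exists h; move=> U.
have -> : (h U : F U -> H U) = g U \o f U by apply/funext => s; exact: hE.
exact: bij_comp (gb U) (fb U).
Qed.

(** Local preimages under an injective morphism are unique, so they agree on overlaps and glue: the
    image presheaf is already a sheaf. *)
Lemma in_image_inj F G (i : Defs.hom F G) : (forall U, injective (i U)) ->
  forall U (s : G U), in_image i s -> exists t, i U t = s.
Proof.
move=> inj U s im.
have /choice[W WP] : forall y : U, exists W : {W : opens k & W `<=` U},
    opens_set (projT1 W) (val y) /\ exists t, i _ t = res (projT2 W) s.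
  move=> y; have [W [h [Wy ht]]] := im _ (set_mem (valP y)).
  by exists (existT _ W h).
have ex (y : U) : exists t, i _ t = res (projT2 (W y)) s by have [_] := WP y.
pose t y := projT1 (cid (ex y)).
have tP y : i _ (t y) = res (projT2 (W y)) s := projT2 (cid (ex y)).
have cov : U `<=` \bigcup_y projT1 (W y).
  by move=> y Uy; exists (exist _ y (mem_set Uy)) => //; have [] := WP (exist _ y (mem_set Uy)).
have [|T TE] := @res_glue k F _ U (fun y => projT1 (W y)) (fun y => projT2 (W y)) t cov.
  move=> y z V hy hz; apply: inj; rewrite !hom_res !tP.
  have hV : V `<=` U by move=> w /hy /(projT2 (W y)).
  by rewrite !(res_comp _ _ hV).
exists T.
apply: (@res_separated k G _ U (fun y => projT1 (W y)) (fun y => projT2 (W y)) _ _ cov) => y.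
by rewrite -hom_res TE tP.
Qed.

Lemma image_in_image F G (i : Defs.hom F G) U (t : F U) : in_image i (i U t).
Proof.
by move=> y Uy; exists U, (@subset_refl _ U); split=> //; exists t; rewrite res_id.
Qed.

Lemma sub_iso F G (i : Defs.hom F G) (N : subsheaf G) : (forall U, injective (i U)) ->
  (forall U (s : G U), s \in @sub_pred k G N U <-> in_image i s) -> iso F (sheaf_of_sub N).
Proof.
move=> inj NP.
have iN U (t : F U) : i U t \in @sub_pred k G N U by apply/NP; exact: image_in_image.
have lin U : linear (fun t : F U => SubSec (iN U t)).
  by move=> a s t; apply: val_inj; rewrite /= linearP.
unshelve eexists (@Defs.Hom k F (sheaf_of_sub N) (fun U => mk_linear (lin U)) _).
  by move=> U V h s /=; apply: val_inj; rewrite /= hom_res.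
move=> U /=.
have /choice[g gP] : forall s : sub_sec N U, exists t, i U t = val s.
  by move=> s; apply: in_image_inj => //; apply/NP; exact: valP.
exists g => s; first by apply: inj; rewrite gP.
by apply: val_inj; exact: gP.
Qed.

(** The multiplicity counts elements of the type [subsheaf], so equality of records is required; the
    closure proofs are identified by proof irrelevance. *)
Lemma subsheaf_eq F (N N' : subsheaf F) :
  (forall U (s : F U), s \in @sub_pred k F N U <-> s \in @sub_pred k F N' U) -> N = N'.
Proof.
case: N N' => p1 a1 b1 c1 [p2 a2 b2 c2] /= E.
have pE : p1 = p2.
  apply: functional_extensionality_dep => U; apply/funext => s.
  by have [h1 h2] := E U s; apply/idP/idP; [exact: h1|exact: h2].
move: a2 b2 c2 E; rewrite -{}pE => a2 b2 c2 _.
by congr Subsheaf; exact: Prop_irrelevance.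
Qed.

Lemma coherent_iso n F G : vector_bundle n F -> iso F G -> coherent G.
Proof.
move=> vb [f fb] x; have [U [e [Ux eb]]] := vb x.
have combE (V : opens k) (h : V `<=` U) c :
    comb h (fun i => f U (e i)) c = f V (comb h e c).
  by rewrite /comb linear_sum; apply: eq_bigr => i _; rewrite linearZ hom_res.
(* A local frame is a presentation without relations, so the relation matrix has no rows. *)
exists U, 0, n, (fun i => f U (e i)), 0; split=> //.
  move=> V h s y Vy; exists V, (@subset_refl _ V), h; split=> //.
  have [g _ gK] := fb V; have [c' _ cK] := eb V h.
  by exists (c' (g s)); rewrite res_id combE cK gK.
move=> V h c; split=> [c0 y Vy|loc].
  exists V, (@subset_refl _ V), h; split=> //; exists 0.
  have -> : c = 0; last first.
    by rewrite mul0mx; apply/matrixP => i j; rewrite !mxE; exact: val_inj.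
  apply: (bij_inj (eb V h)); apply: (bij_inj (fb V)); rewrite -combE c0.
  rewrite /comb big1 ?linear0// => i _; by rewrite mxE scale0r.
suff -> : c = 0 by rewrite /comb big1 // => i _; rewrite mxE scale0r.
apply/rowP => i; rewrite mxE; apply: val_inj; apply/funext => y.
have [W [hV [hU [Wy [b bE]]]]] := loc _ (set_mem (valP y)).
have := congr1 (fun M : 'rV_n => val (M ord0 i) (exist _ (val y) (mem_set Wy))) bE.
rewrite [b](thinmx0) mul0mx !mxE /= => E; rewrite -[RHS]E.
by congr (reg_val _ _); exact: val_inj.
Qed.
End Sheaf.

(** * Fibres of direct sums of line bundles *)

Section SumO.
Variable k : fieldType.
Local Notation K := {fraction {poly k}}.
Local Notation "a %:F" := (@FracField.tofrac {poly k} a).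
Variables (I : finType) (d : I -> int).
Local Notation E := (sumO d : Omod k).
Implicit Types U V : opens k.

Lemma sumO_val_sum (J : finType) U (s : J -> E U) y i :
  sumO_val (\sum_j s j) y i = \sum_j sumO_val (s j) y i.
Proof. exact: (big_morph (fun s : E U => sumO_val s y i)). Qed.

Lemma sumO_twist U (s : E U) y i : twist_stalk (d i) (val y) (sumO_val s y i).
Proof. by have /asboolP[_ h] := valP s; exact: h. Qed.

Lemma sumO_const U (s : E U) y z : sumO_val s y = sumO_val s z.
Proof. by have /asboolP[h _] := valP s; exact: h. Qed.

Lemma sumO_section U (f : I -> K) :
  (forall y i, opens_set U y -> twist_stalk (d i) y (f i)) ->
  exists s : E U, forall y, sumO_val s y = f.
Proof.
move=> h; have hP : (fun=> f) \in @sumO_pred k I d U.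
  by apply/asboolP; split=> // y i; apply: h; exact: set_mem (valP y).
by exists (SumO hP).
Qed.

Section Trivialization.
Variables (U0 : opens k) (w : I -> K).
Hypothesis w0 : forall i, w i != 0.
Hypothesis wP : forall i y f, opens_set U0 y ->
  twist_stalk (d i) y f <-> local_ring y (f / w i).

Lemma sumO_basis : exists e : I -> E U0, forall i y j,
  sumO_val (e i) y j = if j == i then w i else 0.
Proof.
suff /choice[e eP] : forall i, exists s : E U0, forall y j,
    sumO_val s y j = if j == i then w i else 0 by exists e.
move=> i.
have [y j U0y|s sE] := @sumO_section U0 (fun j => if j == i then w i else 0).
  case: eqVneq => [->|_]; last exact: twist_stalk0.
  by apply/wP => //; rewrite divff; [exact: local_ring1|exact: w0].
by exists s => y j; rewrite sE.
Qed.

Lemma sumO_coef V (h : V `<=` U0) (s : E V) :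
  exists a : I -> regular V, forall i y, val (a i) y = sumO_val s y i / w i.
Proof.
suff /choice[a aP] : forall i, exists a : regular V,
    forall y, val a y = sumO_val s y i / w i by exists a.
move=> i; have aP : (fun y => sumO_val s y i / w i) \in @regular_pred k V.
  apply/asboolP; split=> [y z|y]; first by rewrite (sumO_const s y z).
  by apply/wP; [exact: h (set_mem (valP y))|exact: sumO_twist].
by exists (Regular aP).
Qed.

Lemma sumO_comb V (h : V `<=` U0) (s : E V) (e : I -> E U0) (a : I -> regular V) :
  (forall i y j, sumO_val (e i) y j = if j == i then w i else 0) ->
  (forall i y, val (a i) y = sumO_val s y i / w i) ->
  s = \sum_i a i *: res h (e i).
Proof.
move=> eP aP; apply: val_inj; apply/funext => y; apply/funext => j.
rewrite [RHS]sumO_val_sum (bigD1 j)//= big1 => [|i ij].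
  by rewrite /rst eP eqxx aP divfK ?addr0; [|exact: w0].
by rewrite /rst eP eq_sym (negbTE ij) mulr0.
Qed.

End Trivialization.
End SumO.

HB.instance Definition _ (k : fieldType) (x : P1 k) :=
  GRing.isZmodMorphism.Build k (residue_field x) (@germ_const k x)
    (fun a b => etrans (germ_constD x a (- b))
       (congr1 (fun z => germ_const x a + z) (germ_constN x b))).
HB.instance Definition _ (k : fieldType) (x : P1 k) :=
  GRing.isMonoidMorphism.Build k (residue_field x) (@germ_const k x)
    (germ_const1 x, germ_constM x).

Section Fiber.
Variable k : fieldType.
Local Notation K := {fraction {poly k}}.
Variables (x : P1 k) (hdeg : degree x 1).
Variables (u : int -> K) (pi : K) (U0 : opens k) (fr : local_frame x u pi U0).
Variables (I : finType) (d : I -> int).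
Local Notation E := (sumO d : Omod k).
Implicit Types U V : opens k.

(** Division by the generator [u (d i)] of O(d i) turns each component into a function regular at x.
    The resulting coordinates identify the fibre of E at x with the functions from I to k. *)
Definition fiber U (s : E U) (hx : x \in opens_set U) : I -> k :=
  fun i => ev x (sumO_val s (exist _ x hx) i / u (d i)).

Lemma fiber_local_ring U (s : E U) (hx : x \in opens_set U) i :
  local_ring x (sumO_val s (exist _ x hx) i / u (d i)).
Proof. by apply/(frame_twist fr); [exact: (frame_in fr)|exact: sumO_twist]. Qed.

Lemma fiberP U a (s t : E U) (hx : x \in opens_set U) :
  fiber (a *: s + t) hx =
  fun i => ev x (val a (exist _ x hx)) * fiber s hx i + fiber t hx i.
Proof.
apply/funext => i; rewrite /fiber /= mulrDl -mulrA.
have al : local_ring x (val a (exist _ x hx)).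
  by have /asboolP[_ h] := valP a; exact: h.
have hs := fiber_local_ring s hx i; have ht := fiber_local_ring t hx i.
by rewrite (evD hdeg (local_ringM al hs) ht) (evM hdeg al hs).
Qed.

Lemma fiber_res U V (h : V `<=` U) (s : E U) (hx : x \in opens_set V)
    (hx' : x \in opens_set U) : fiber (res h s) hx = fiber s hx'.
Proof.
apply/funext => i; rewrite /fiber /= /rst; congr (ev x (sumO_val s _ i / _)).
exact: val_inj.
Qed.

Lemma fiber0 U (hx : x \in opens_set U) : fiber (0 : E U) hx = fun=> 0.
Proof. by apply/funext => i; rewrite /fiber /= mul0r (ev0 hdeg). Qed.

Lemma fiber_section (c : I -> k) : exists s : E U0, forall hx, fiber s hx = c.
Proof.
have [y i U0y|s sE] := @sumO_section k I d U0
    (fun i => @FracField.tofrac {poly k} (c i)%:P * u (d i)).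
  apply/(frame_twist fr) => //; rewrite mulfK ?(frame_neq0 fr)//.
  exact: local_ring_const.
exists s => hx; apply/funext => i.
by rewrite /fiber sE mulfK ?(frame_neq0 fr)// (evC hdeg).
Qed.

Lemma residue_germ U (hx : x \in opens_set U) (a : regular U) :
  residue (germ hx a) = germ_const x (ev x (val a (exist _ x hx))).
Proof. by rewrite -(ev_residue hdeg). Qed.

Lemma germ_const_mx r (v : 'rV[residue_field x]_r) :
  exists v' : 'rV[k]_r, v = map_mx (germ_const x) v'.
Proof.
have /choice[g gP] := germ_const_surj hdeg.
by exists (map_mx g v); apply/rowP => i; rewrite !mxE.
Qed.

Variable r : nat.
Local Notation sky := (skyscraper x r).
Local Notation lift := (map_mx (@germ_const k x)).

(** A section of the skyscraper sheaf is not changed at x by restriction to the intersection with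
    [U0]. There every section of E is a combination of the basis sections, and its coefficients act
    through their values at x. *)
Lemma sky_hom_matrix (p : Defs.hom E sky) : exists M : I -> 'rV[k]_r,
  forall U (s : E U) (hx : x \in opens_set U),
    p U s hx = lift (\sum_i fiber s hx i *: M i).
Proof.
have w0 i : u (d i) != 0 := frame_neq0 fr (d i).
have wP i y f : opens_set U0 y -> twist_stalk (d i) y f <-> local_ring y (f / u (d i)).
  exact: (frame_twist fr).
have [e eP] := sumO_basis w0 wP.
have hx0 : x \in opens_set U0 by apply: mem_set; exact: (frame_in fr).
have /choice[M ME] i := germ_const_mx (p U0 (e i) hx0).
exists M => U s hx.
pose V := Opens (openI (opens_open U) (opens_open U0)).
have hU : V `<=` U by move=> y [].
have h0 : V `<=` U0 by move=> y [].
have hV : x \in opens_set V.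
  by apply: mem_set; split; [exact: set_mem|exact: (frame_in fr)].
have [a aP] := sumO_coef wP h0 (res hU s).
have -> : p U s hx = p V (res hU s) hV.
  by rewrite hom_res /= /sky_res; congr (p U s _); exact: bool_irrelevance.
rewrite (sumO_comb w0 h0 eP aP) linear_sum.
have -> : (\sum_i p V (a i *: res h0 (e i)) : sky V) hV =
    \sum_i p V (a i *: res h0 (e i)) hV by rewrite fct_sumE.
rewrite map_mx_sum; apply: eq_bigr => i _.
rewrite linearZ /= map_mxZ [LHS]/(sky_scale _ _ _) /sky_scale residue_germ aP.
congr (germ_const x _ *: _).
  rewrite -(fiber_res hU _ hV).
  by [].
rewrite hom_res /= /sky_res -ME; congr (p U0 _ _); exact: bool_irrelevance.
Qed.

Lemma sky_hom_exists (M : I -> 'rV[k]_r) : exists p : Defs.hom E sky,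
  forall U (s : E U) (hx : x \in opens_set U),
    p U s hx = lift (\sum_i fiber s hx i *: M i).
Proof.
pose F U (s : E U) : sky U := fun hx => lift (\sum_i fiber s hx i *: M i).
have lin U : linear (@F U).
  move=> a s t; apply/funext => hx.
  have -> : (a *: F U s + F U t) hx = residue (germ hx a) *: F U s hx + F U t hx by [].
  rewrite residue_germ /F -map_mxZ -map_mxD; congr (map_mx _ _).
  rewrite fiberP scaler_sumr -big_split /=.
  by apply: eq_bigr => i _; rewrite scalerDl scalerA.
unshelve eexists (@Defs.Hom k E sky (fun U => mk_linear (lin U)) _).
  move=> U V h s; apply/funext => hx /=; rewrite /F /sky_res.
  by rewrite (fiber_res h s hx (mem_set (h _ (set_mem hx)))).
by [].
Qed.

End Fiber.

(** * Surjections onto k^r and the echelon forms of their kernels *)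

Section Kernel.
Variables (k : fieldType) (I : finType) (r : nat).
Implicit Types (M : I -> 'rV[k]_r) (D : {set I}).

Definition comb_ker M : set (I -> k) := [set c | \sum_i c i *: M i = 0].

Lemma linear_comb_ker M : linear_set (comb_ker M).
Proof.
split=> [|a c c' Hc Hc']; first by rewrite /comb_ker/= big1// => i _; rewrite scale0r.
rewrite /comb_ker/=; have -> : \sum_i (a * c i + c' i) *: M i =
    a *: (\sum_i c i *: M i) + \sum_i c' i *: M i.
  by rewrite scaler_sumr -big_split/=; apply: eq_bigr => i _; rewrite scalerDl scalerA.
by rewrite Hc Hc' scaler0 addr0.
Qed.

(** The rows of M indexed by D form a basis of k^r. They span because any c can be changed by an
    element of the kernel until it is supported on D; they are independent because an element of the
    graph supported on D is 0. *)
Lemma card_comb_ker M D N : (forall v, exists c, \sum_i c i *: M i = v) ->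
  comb_ker M = graph D N -> #|D| = r.
Proof.
move=> surj kerE.
pose A := \matrix_(a < #|D|) M (enum_val a).
have AE (c : I -> k) : (\row_(a < #|D|) c (enum_val a)) *m A = \sum_(j in D) c j *: M j.
  rewrite mulmx_sum_row [RHS]big_enum_val; apply: eq_bigr => a _.
  by rewrite mxE rowK.
have fullA : row_full A.
  rewrite -sub1mx; apply/row_subP => i; have [c cE] := surj (row i 1%:M).
  (* What remains on D after subtracting from c the element of the graph with the same coordinates
     outside D. *)
  pose c' j := c j - \sum_(i | i \notin D) c i * N i j.
  suff -> : row i 1%:M = \sum_(j in D) c' j *: M j by rewrite -AE submxMl.
  have : graph D N (fun j => c j - if j \in D then c' j else 0).
    move=> j jD; rewrite jD /c' opprB addrC subrK.
    by apply: eq_bigr => l lD; rewrite (negbTE lD) subr0.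
  rewrite -kerE -cE /comb_ker/= => /eqP.
  under eq_bigr do rewrite scalerBl; rewrite sumrB subr_eq0 => /eqP ->.
  rewrite [RHS]big_mkcond; apply: eq_bigr => j _.
  by case: ifP => //; rewrite scale0r.
have freeA : row_free A.
  apply: inj_row_free => v vA.
  pose c j := \sum_(a | enum_val a == j) v 0 a.
  have cE a : c (enum_val a) = v 0 a.
    by rewrite /c (eq_bigl (pred1 a)) ?big_pred1_eq// => b; rewrite /= (inj_eq enum_val_inj).
  have c0 j : j \notin D -> c j = 0.
    move=> jD; rewrite /c big1// => a /eqP aj.
    by move: jD; rewrite -aj enum_valP.
  have : comb_ker M c.
    rewrite /comb_ker/= (bigID (mem D)) /= [X in _ + X]big1 => [|j /c0 ->].
      rewrite addr0 -AE (_ : \row_a _ = v)//.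
      by apply/rowP => a; rewrite mxE cE.
    by rewrite scale0r.
  rewrite kerE => Hc; apply/rowP => a; rewrite mxE -cE Hc ?enum_valP// big1// => i iD.
  by rewrite c0// mul0r.
have := freeA; rewrite /row_free => /eqP <-.
by have := fullA; rewrite /row_full => /eqP.
Qed.

(** The columns of M are the equations of the graph, one for each element of D. They can be given
    arbitrary values by vectors supported on D. *)
Lemma comb_ker_graph D N : #|D| = r -> exists M,
  (forall v, exists c, \sum_i c i *: M i = v) /\ comb_ker M = graph D N.
Proof.
move=> Dr.
pose el (a : 'I_r) := enum_val (cast_ord (esym Dr) a).
have elD a : el a \in D by exact: enum_valP.
have elP j : j \in D -> exists a, el a = j.
  by move=> jD; exists (cast_ord Dr (enum_rank_in jD j)); rewrite /el cast_ordK enum_rankK_in.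
have el_inj : injective el by move=> a b /enum_val_inj/cast_ord_inj.
pose M i := \row_(a < r) ((i == el a)%:R - (if i \in D then 0 else N i (el a))).
have ME c a : (\sum_i c i *: M i) 0 a =
    c (el a) - \sum_(i | i \notin D) c i * N i (el a).
  rewrite summxE [X in _ - X]big_mkcond -[c (el a)](@big_pred1_eq _ _ +%R _ (el a)) big_mkcond.
  rewrite -sumrB; apply: eq_bigr => i _; rewrite !mxE mulrBr.
  congr (_ - _); last by case: (i \in D); rewrite ?mulr0.
  by rewrite /=; case: (i == el a); rewrite ?mulr1 ?mulr0.
exists M; split=> [v|].
  exists (fun i => \sum_(a | el a == i) v 0 a); apply/rowP => a; rewrite ME.
  rewrite (eq_bigl (pred1 a)) ?big_pred1_eq => [|b]; last by rewrite /= (inj_eq el_inj).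
  rewrite [X in _ - X]big1 ?subr0// => i iD; rewrite big1 ?mul0r// => b /eqP bi.
  by move: iD; rewrite -bi elD.
apply/seteqP; split=> c.
  move=> Hc j /elP[a <-]; apply/eqP; rewrite -subr_eq0 -ME.
  by rewrite Hc mxE.
move=> Hc; apply/rowP => a; rewrite ME mxE; apply/eqP; rewrite subr_eq0; apply/eqP.
exact: Hc.
Qed.

End Kernel.

(** * Subsheaves cut out by a subspace of the fibre at x *)

Section FiberSub.
Variable k : fieldType.
Local Notation K := {fraction {poly k}}.
Variables (x : P1 k) (hdeg : degree x 1) (hx : closed [set x]).
Variables (u : int -> K) (pi : K) (U0 : opens k) (fr : local_frame x u pi U0).
Variables (I : finType) (d : I -> int).
Local Notation E := (sumO d : Omod k).
Local Notation fiber := (fiber u).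
Implicit Types U V : opens k.

Section Sub.
Variables (H : set (I -> k)) (lH : linear_set H).

(** The condition is vacuous when x is not in U: these subsheaves coincide with E away from x. *)
Definition fiber_pred U : {pred E U} :=
  fun s => `[< forall h : x \in opens_set U, H (fiber s h) >].

Lemma fiber_pred_submod U : submod_closed (@fiber_pred U).
Proof.
split; first by apply/asboolP => h; rewrite (fiber0 hdeg); exact: lH.1.
move=> a s t /asboolP hs /asboolP ht; apply/asboolP => h.
by rewrite (fiberP hdeg fr); exact: lH.2.
Qed.

Lemma fiber_pred_res U V (h : V `<=` U) (s : E U) :
  s \in @fiber_pred U -> res h s \in @fiber_pred V.
Proof.
move=> /asboolP hs; apply/asboolP => hV.
rewrite (fiber_res u h s hV (mem_set (h _ (set_mem hV)))); exact: hs.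
Qed.

Lemma fiber_pred_local (J : Type) U (W : J -> opens k) (h : forall i, W i `<=` U)
    (s : E U) : U `<=` \bigcup_i W i ->
  (forall i, res (h i) s \in @fiber_pred (W i)) -> s \in @fiber_pred U.
Proof.
move=> cov hs; apply/asboolP => hU.
have [i _ Wx] := cov _ (set_mem hU).
have /asboolP := hs i; move=> /(_ (mem_set Wx)).
by rewrite (fiber_res u (h i) s (mem_set Wx) hU).
Qed.

Definition fiber_sub : subsheaf E :=
  Subsheaf fiber_pred_submod fiber_pred_res fiber_pred_local.

Lemma fiber_subP U (s : E U) : s \in @sub_pred k E fiber_sub U <->
  forall h : x \in opens_set U, H (fiber s h).
Proof. by split=> [/asboolP|h]; last exact/asboolP. Qed.

End Sub.

(** Every vector of the fibre is the value of a section over [U0], so the subsheaf determines the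
    subspace. *)
Lemma fiber_sub_inj H H' (lH : linear_set H) (lH' : linear_set H') :
  fiber_sub lH = fiber_sub lH' -> H = H'.
Proof.
have x0 : x \in opens_set U0 := mem_set (frame_in fr).
suff sub H1 H2 (l1 : linear_set H1) (l2 : linear_set H2) :
    fiber_sub l1 = fiber_sub l2 -> H1 `<=` H2.
  by move=> e; apply/seteqP; split; [exact: sub e|exact: sub (esym e)].
move=> e c Hc; have [s sE] := fiber_section hdeg fr d c.
have : s \in @sub_pred k E (fiber_sub l1) U0 by apply/fiber_subP => h; rewrite sE.
by rewrite e => /fiber_subP/(_ x0); rewrite sE.
Qed.

Variable r : nat.
Local Notation sky := (skyscraper x r).
Local Notation lift := (map_mx (@germ_const k x)).
Variables (p : Defs.hom E sky) (M : I -> 'rV[k]_r).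
Hypothesis pM : forall U (s : E U) (h : x \in opens_set U),
  p U s h = lift (\sum_i fiber s h i *: M i).

Lemma sky_hom_eq0 U (s : E U) :
  p U s = 0 <-> s \in @sub_pred k E (fiber_sub (linear_comb_ker M)) U.
Proof.
rewrite fiber_subP; split=> [s0 h|hs].
  have := pM s h; rewrite s0 => /esym e; rewrite /comb_ker /=.
  apply/rowP => i; apply: (@germ_const_inj k x); rewrite [in RHS]mxE germ_const0.
  by have := congr1 (fun z : 'rV_r => z 0 i) e; rewrite [in LHS]mxE => ->; rewrite mxE.
by apply/funext => h; rewrite pM (hs h) map_mx0.
Qed.

Lemma sky_hom_surj : (forall U (s : sky U), in_image p s) <->
  (forall v, exists c, \sum_i c i *: M i = v).
Proof.
have x0 : x \in opens_set U0 := mem_set (frame_in fr).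
split=> [im v|surj U s y Uy].
  have [V [h [Vx [t tE]]]] := im (opensT k) (fun=> lift v) x Logic.I.
  have := congr1 (fun z => z (mem_set Vx)) tE; rewrite pM => e.
  exists (fiber t (mem_set Vx)).
  apply/rowP => i; apply: (@germ_const_inj k x).
  by have := congr1 (fun z : 'rV_r => z 0 i) e; rewrite /= /sky_res ![in X in X -> _]mxE.
have [yx|yx] := pselect (y = x); last first.
  (* Away from the closed point x the skyscraper sheaf is zero, so the zero section is a local
     preimage. *)
  have oV : open (~` [set x]) by exact: closed_openC.
  exists (Opens (openI (opens_open U) oV)), (@subIsetl _ _ _); split=> //.
  by exists 0; apply/funext => h; case: (set_mem h) => _ /=; case.
subst y; have [v vE] := germ_const_mx hdeg (s (mem_set Uy)).
have [c cE] := surj v; have [t tE] := fiber_section hdeg fr d c.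
pose V := Opens (openI (opens_open U) (opens_open U0)).
have hU : V `<=` U by move=> z [].
have h0 : V `<=` U0 by move=> z [].
exists V, hU; split; first by split=> //; exact: (frame_in fr).
exists (res h0 t); apply/funext => h; rewrite pM (fiber_res u h0 t h x0) tE cE -vE.
by rewrite /= /sky_res; congr s; exact: bool_irrelevance.
Qed.

End FiberSub.

(** * The subsheaf of an echelon form as a direct sum of line bundles *)

Section Twist.
Variable k : fieldType.
Local Notation K := {fraction {poly k}}.
Local Notation "a %:F" := (@FracField.tofrac {poly k} a).

Lemma twist_stalkD y (e : int) (f g : K) :
  twist_stalk e y f -> twist_stalk e y g -> twist_stalk e y (f + g).
Proof.
move=> hf hg; rewrite -[g]opprK; apply: twist_stalkB => //.
by rewrite -sub0r; apply: twist_stalkB => //; exact: twist_stalk0.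
Qed.

Lemma twist_stalk_sum y (e : int) (J : finType) (P : pred J) (F : J -> K) :
  (forall j, P j -> twist_stalk e y (F j)) -> twist_stalk e y (\sum_(j | P j) F j).
Proof.
move=> h; elim/big_rec: _ => [|j z Pj Hz]; first exact: twist_stalk0.
by apply: twist_stalkD => //; exact: h.
Qed.

Variables (x : P1 k) (hdeg : degree x 1).
Variables (u : int -> K) (pi : K) (U0 : opens k) (fr : local_frame x u pi U0).
Variables (I : finType) (d : I -> int) (D : {set I}) (N : I -> I -> k).
Hypothesis Nmono : forall i j, N i j != 0 -> d i <= d j.

Let d' i : int := d i - ((i \in D) : nat)%:Z.

(** The off-diagonal part of the unipotent automorphism: multiplication by u(d j) / u(d i) extends
    the constant N i j to a map from O(d i) to O(d j). *)
Let shear (s : I -> K) j : K :=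
  \sum_(i | i \notin D) s i * (N i j)%:P%:F * (u (d j) / u (d i)).

Lemma shear_twist y s j : (forall i, i \notin D -> twist_stalk (d i) y (s i)) ->
  twist_stalk (d j) y (shear s j).
Proof.
move=> h; apply: twist_stalk_sum => i iD.
have [->|/Nmono dij] := eqVneq (N i j) 0.
  by rewrite polyC0 tofrac0 mulr0 mul0r; exact: twist_stalk0.
apply: (frame_mono fr) => //; rewrite mulrC; apply: twist_stalkM; last exact: h.
exact: local_ring_const.
Qed.

Lemma shear_local s j : (forall i, i \notin D -> local_ring x (s i / u (d i))) ->
  local_ring x (shear s j / u (d j)) /\
  ev x (shear s j / u (d j)) = \sum_(i | i \notin D) ev x (s i / u (d i)) * N i j.
Proof.
move=> h; have sE : shear s j / u (d j) =
    \sum_(i | i \notin D) s i / u (d i) * (N i j)%:P%:F.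
  rewrite mulr_suml; apply: eq_bigr => i _.
  by rewrite mulrA [LHS]mulrAC mulfK ?(frame_neq0 fr)// mulrAC.
have hl i : i \notin D -> local_ring x (s i / u (d i) * (N i j)%:P%:F).
  by move=> iD; apply: local_ringM; [exact: h|exact: local_ring_const].
rewrite sE; split; first exact: local_ring_sum.
rewrite (ev_sum hdeg hl); apply: eq_bigr => i iD.
by rewrite (evM hdeg (h i iD) (local_ring_const x _)) (evC hdeg).
Qed.

(* up is the map from the sum of the O(d i - 1_D(i)) to E whose i-th row, for i
   not in D, is the i-th row of the echelon form of graph D N. *)
Let up (s : I -> K) j : K := if j \in D then s j * pi + shear s j else s j.
Let down (s : I -> K) j : K := if j \in D then (s j - shear s j) / pi else s j.

(** Only coordinates outside D enter [shear], and [up] and [down] leave these unchanged; this makes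
    the two maps mutually inverse. *)
Lemma eq_shear s t : (forall i, i \notin D -> s i = t i) -> shear s = shear t.
Proof. by move=> h; apply/funext => j; apply: eq_bigr => i iD; rewrite h. Qed.

Lemma upK s : down (up s) = s.
Proof.
have E : shear (up s) = shear s by apply: eq_shear => i /negbTE iD; rewrite /up iD.
apply/funext => j; rewrite /down E /up; case: (j \in D) => //.
by rewrite addrK mulfK ?(unif_neq0 fr).
Qed.

Lemma downK s : up (down s) = s.
Proof.
have E : shear (down s) = shear s by apply: eq_shear => i /negbTE iD; rewrite /down iD.
apply/funext => j; rewrite /up E /down; case: (j \in D) => //.
by rewrite divfK ?(unif_neq0 fr)// subrK.
Qed.

Lemma up_twist y s : (forall i, twist_stalk (d' i) y (s i)) ->
  forall j, twist_stalk (d j) y (up s j).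
Proof.
move=> h j; have hD i : i \notin D -> twist_stalk (d i) y (s i).
  by move=> iD; have := h i; rewrite /d' (negbTE iD) subr0.
rewrite /up; case: ifPn => [jD|]; last exact: hD.
apply: twist_stalkD; last exact: shear_twist.
have := h j; rewrite /d' jD => hj.
have [yx|yx] := pselect (y = x); first by subst y; exact: (unif_mul fr).
by apply/(unif_off fr _ _ yx); rewrite mulfK ?(unif_neq0 fr).
Qed.

(** The term containing [pi] vanishes at x, and what is left of a coordinate in D is the value
    prescribed by the graph. *)
Lemma up_graph s : (forall i, twist_stalk (d' i) x (s i)) ->
  graph D N (fun i => ev x (up s i / u (d i))).
Proof.
move=> h j jD; have hD i : i \notin D -> local_ring x (s i / u (d i)).
  move=> iD; apply/(frame_twist fr); first exact: (frame_in fr).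
  by have := h i; rewrite /d' (negbTE iD) subr0.
have [hl hE] := shear_local j hD.
have := h j; rewrite /d' jD => hj.
have hp : local_ring x (s j * pi / u (d j)).
  apply/(frame_twist fr); [exact: (frame_in fr)|exact: (unif_mul fr)].
rewrite /up jD mulrDl (evD hdeg hp hl) hE [X in X + _](_ : _ = 0) ?add0r.
  by apply: eq_bigr => i /negbTE ->.
by apply/(unif_ev fr (d j) hp); rewrite divfK ?(frame_neq0 fr)// mulfK ?(unif_neq0 fr).
Qed.

(** The graph condition says that the difference of s_j and its shear vanishes at x, which permits
    the division by [pi] there; at other points this division always carries O(d j) to O(d j -
    1). *)
Lemma down_twist y s : (forall i, twist_stalk (d i) y (s i)) ->
  (y = x -> graph D N (fun i => ev x (s i / u (d i)))) ->
  forall j, twist_stalk (d' j) y (down s j).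
Proof.
move=> h hg j; rewrite /d' /down; case: ifPn => jD; last by rewrite subr0.
have hB : twist_stalk (d j) y (s j - shear s j).
  by apply: twist_stalkB => //; apply: shear_twist => i _; exact: h.
have [yx|yx] := pselect (y = x); last exact: ((unif_off fr (d j) _ yx).1 hB).
subst y; have hl i : local_ring x (s i / u (d i)).
  by apply/(frame_twist fr); [exact: (frame_in fr)|exact: h].
have [sl sE] := @shear_local s j (fun i _ => hl i).
have hBl : local_ring x ((s j - shear s j) / u (d j)).
  by rewrite mulrBl; exact: local_ringB.
rewrite -(divfK (frame_neq0 fr (d j)) (s j - shear s j)).
apply/(unif_ev fr (d j) hBl).
by rewrite mulrBl (evB hdeg (hl j) sl) sE (hg erefl j jD) subrr.
Qed.

Lemma up_linear (a : K) s t j : up (fun i => a * s i + t i) j = a * up s j + up t j.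
Proof.
rewrite /up; case: ifP => // _.
have -> : shear (fun i => a * s i + t i) j = a * shear s j + shear t j.
  rewrite mulr_sumr -big_split/=; apply: eq_bigr => i _.
  by rewrite !mulrDl !mulrA.
by rewrite mulrDr mulrDl mulrA addrACA.
Qed.

Lemma twist_iso_fiber_sub (lH : linear_set (graph D N)) :
  iso (sumO (fun i => d i - ((i \in D) : nat)%:Z))
      (sheaf_of_sub (fiber_sub hdeg fr d lH)).
Proof.
have upP U (s : sumO d' U) : (fun y => up (sumO_val s y)) \in @sumO_pred k I d U.
  apply/asboolP; split=> [y z|y i]; first by rewrite (sumO_const s y z).
  by apply: up_twist => l; exact: sumO_twist.
have lin U : linear (fun s : sumO d' U => SumO (upP U s) : sumO d U).
  move=> a s t; apply: val_inj; apply/funext => y; apply/funext => j.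
  exact: up_linear.
have fres (U V : opens k) (h : V `<=` U) (s : sumO d' U) :
    mk_linear (lin V) (res h s) = res h (mk_linear (lin U) s) by exact: val_inj.
pose f := @Defs.Hom k (sumO d') (sumO d) (fun U => mk_linear (lin U)) fres.
have inj U : injective (f U).
  move=> s t /(congr1 val) e; apply: val_inj; apply/funext => y.
  by apply: (can_inj upK); exact: (congr1 (@^~ y) e).
apply: (sub_iso inj) => U s; rewrite fiber_subP; split=> [hs|/(in_image_inj inj)[t <-] h].
  have tP : (fun y => down (sumO_val s y)) \in @sumO_pred k I d' U.
    apply/asboolP; split=> [y z|y i]; first by rewrite (sumO_const s y z).
    apply: down_twist => [l|yx]; first exact: sumO_twist.
    have h : x \in opens_set U by rewrite -yx; exact: valP.
    by have := hs h; rewrite /fiber (sumO_const s _ y).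
  suff <- : f U (SumO tP) = s by exact: image_in_image.
  by apply: val_inj; apply/funext => y; exact: downK.
apply: up_graph => i; exact: (sumO_twist t (exist _ x h) i).
Qed.

End Twist.

(** * Uniqueness of the splitting type *)

Section Splitting.
Variable k : fieldType.
Local Notation K := {fraction {poly k}}.
Local Notation "a %:F" := (@FracField.tofrac {poly k} a).

Lemma monic_irreducible_factor (b : {poly k}) : (1 < size b)%N ->
  exists p, [/\ p \is monic, irreducible_poly p & p %| b].
Proof.
elim: {b}(size b) {-2}b (leqnn (size b)) => [b|n IH b bn b1].
  by rewrite leqn0 => /eqP ->.
have b0 : b != 0 by rewrite -size_poly_gt0 (leq_trans _ b1).
have [irr|nirr] := pselect (irreducible_poly b).
  exists ((lead_coef b)^-1 *: b).
  have l0 : (lead_coef b)^-1 != 0 by rewrite invr_eq0 lead_coef_eq0.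
  split; last by rewrite dvdpZl.
    by rewrite monicE lead_coefZ mulVf// lead_coef_eq0.
  split; first by rewrite size_scale.
  move=> q q1; rewrite dvdpZr// => /(irr.2 _ q1) qb.
  by rewrite (eqp_trans qb)// eqp_sym eqp_scale.
have [q [q1 qb nqb]] : exists q : {poly k}, [/\ size q != 1, q %| b & ~~ (q %= b)].
  apply: contrapT => no; apply: nirr; split=> // q q1 qb.
  by apply/negPn/negP => nqb; apply: no; exists q.
have q0 : q != 0 by apply: contraNneq b0 => q0; rewrite -dvd0p -q0.
have qsb : (size q < size b)%N.
  by rewrite ltn_neqAle dvdp_leq// andbT dvdp_size_eqp.
have [] := IH q; first by rewrite -ltnS (leq_trans qsb).
  by rewrite ltn_neqAle eq_sym q1 size_poly_gt0.
by move=> p [pm pI pq]; exists p; split=> //; exact: dvdp_trans qb.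
Qed.

(** In lowest terms, an irreducible factor of the denominator would give a pole at the corresponding
    point. *)
Lemma regular_off_infty (f : K) :
  (forall y : P1 k, y <> Infinity -> local_ring y f) -> exists a, f = a%:F.
Proof.
move=> h; have [a0 [b0 [b00 fE]]] := function_fieldE f.
have [a [b [b0' cop {}fE]]] : exists a b : {poly k},
    [/\ b != 0, coprimep a b & f = a%:F / b%:F].
  pose g := gcdp a0 b0; have g0 : g != 0 by rewrite gcdp_eq0 negb_and b00 orbT.
  have aE : a0 = a0 %/ g * g by rewrite divpK// dvdp_gcdl.
  have bE : b0 = b0 %/ g * g by rewrite divpK// dvdp_gcdr.
  exists (a0 %/ g), (b0 %/ g); split.
  - by apply: contraNneq b00 => e; rewrite bE e mul0r.
  - by apply: coprimep_div_gcd; rewrite b00 orbT.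
  - have g0F : g%:F != 0 by rewrite tofrac_eq0.
    by rewrite fE {1}aE {1}bE !tofracM invfM mulrACA mulfV ?mulr1.
have [b1|b1] := leqP (size b) 1.
  have /size_poly1P[c c0 bE] : size b == 1 by rewrite eqn_leq b1 size_poly_gt0.
  exists (c^-1 *: a); rewrite fE bE; apply: (canLR (mulfK _)).
    by rewrite tofrac_eq0 polyC_eq0.
  by rewrite -tofracM mulrC mul_polyC scalerA mulfV// scale1r.
have [p [pm pI pb]] := monic_irreducible_factor b1.
have [//|a' [b' [pb' fE']]] := h (Defs.Finite pm pI).
have b'0 : b' != 0 by apply: contraNneq pb' => ->; rewrite dvdp0.
have e := tofrac_div_eq b0' b'0 (etrans (esym fE) fE').
have pa : p %| a.
  apply/negPn/negP => pa; have := irreducible_dvdpM pI pa pb'.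
  by rewrite e dvdp_mull.
have : p %| gcdp a b by rewrite dvdp_gcd pa.
have cop1 : gcdp a b %= 1 by rewrite gcdp_eqp1.
by rewrite (eqp_dvdr _ cop1) dvdp1 (gtn_eqF pI.1).
Qed.

(** This is the absence of nonzero global sections of O(-n-1), by comparison of degrees at
    infinity. *)
Lemma poly_pole (a : {poly k}) (n : nat) :
  local_ring Infinity (a%:F * 'X%:F ^+ n.+1) -> a = 0.
Proof.
move=> [b [c [c0 bc]]]; rewrite -tofracXn -tofracM => e.
have := @tofrac_div_eq _ (a * 'X^(n.+1)) 1 b c (oner_neq0 _) c0.
rewrite tofrac1 divr1 => /(_ e); rewrite mulr1 => bE.
apply/eqP/negPn/negP => a0; move: bc; rewrite -bE.
have aX0 : a * 'X^(n.+1) != 0 by rewrite mulf_neq0// monic_neq0// monicXn.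
rewrite size_mul// size_mulXn// addSn addSn /= leqNgt => /negP; apply.
by rewrite -addn1 addnC leq_add// addn_gt0 size_poly_gt0 a0 orbT.
Qed.

Section HomMatrix.
Variables (I J : finType) (d : I -> int) (d' : J -> int).

Definition off_infty : opens k := opensD1 (@infty_neq_Generic k).

(** The entry at (i, j) amounts to a global section of O(d' j - d i): the chart off infinity makes
    it a polynomial, and the chart off 0 bounds its order at infinity. *)
Lemma sumO_hom_matrix (f : Defs.hom (sumO d : Omod k) (sumO d')) :
  exists A : I -> J -> K,
    (forall U (s : sumO d U) y j,
       sumO_val (f U s) y j = \sum_i sumO_val s y i * A i j) /\
    (forall i j, d' j < d i -> A i j = 0).
Proof.
have w0 (i : I) : (1 : K) != 0 by exact: oner_neq0.
have wP i y (g : K) : opens_set off_infty y ->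
    twist_stalk (d i) y g <-> local_ring y (g / 1).
  by move=> yi; rewrite twist_stalk_finite// divr1.
have [e eP] := sumO_basis w0 wP.
have Gi : opens_set off_infty (Generic : P1 k) by [].
pose A i j := sumO_val (f off_infty (e i)) (exist _ Generic (mem_set Gi)) j.
have AE U (s : sumO d U) y j : sumO_val (f U s) y j = \sum_i sumO_val s y i * A i j.
  pose V := Opens (openI (opens_open U) (opens_open off_infty)).
  have hU : V `<=` U by move=> z [].
  have h0 : V `<=` off_infty by move=> z [].
  have GV : opens_set V Generic by split=> //; exact: opens_generic (set_mem (valP y)).
  pose g : V := exist _ Generic (mem_set GV).
  have [a aP] := sumO_coef wP h0 (res hU s).
  have -> : sumO_val (f U s) y j = sumO_val (f V (res hU s)) g j.
    by rewrite hom_res /= /rst (sumO_const _ y (Defs.incl hU g)).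
  rewrite (sumO_comb w0 h0 eP aP) linear_sum sumO_val_sum.
  apply: eq_bigr => i _; rewrite linearZ /= aP divr1 hom_res /= /rst.
  rewrite (sumO_const s (Defs.incl hU g) y); congr (_ * sumO_val _ _ _).
  exact: val_inj.
exists A; split=> // i j dij.
have [a aE] : exists a, A i j = a%:F.
  apply: regular_off_infty => y yi.
  have Uy : opens_set off_infty y by [].
  have := sumO_twist (f off_infty (e i)) (exist _ y (mem_set Uy)) j.
  by rewrite twist_stalk_finite// (sumO_const _ _ (exist _ Generic (mem_set Gi))).
pose U2 := opensD1 (@point_neq_Generic k 0).
have v0 (l : I) : ('X%:F : K) ^ d l != 0 by rewrite expfz_neq0// tofracX_neq0.
have vP l y (g : K) : opens_set U2 y ->
    twist_stalk (d l) y g <-> local_ring y (g / 'X%:F ^ d l).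
  exact: twist_stalk_infty_frame.
have [e2 e2P] := sumO_basis v0 vP.
have U2i : opens_set U2 (Infinity : P1 k) by [].
have := sumO_twist (f U2 (e2 i)) (exist _ Infinity (mem_set U2i)) j.
rewrite AE (bigD1 i)//= big1 => [|l li]; last by rewrite e2P (negbTE li) mul0r.
rewrite e2P eqxx addr0 -/(local_ring Infinity _) aE.
(* The strict inequality of degrees leaves the positive exponent that [poly_pole] requires. *)
have [n nE] : exists n : nat, d i = d' j + n.+1%:Z.
  exists `|(d i - d' j - 1)%R|%N; rewrite -addn1 PoszD gez0_abs; last first.
    by rewrite subr_ge0 -gtz0_ge1 subr_gt0.
  by rewrite subrK addrC subrK.
rewrite nE (expfzDr _ _ (tofracX_neq0 k)) mulrAC [_ ^ d' j * _]mulrC mulfK.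
  by rewrite mulrC => /poly_pole ->; rewrite tofrac0.
exact: expfz_neq0 (tofracX_neq0 k).
Qed.

End HomMatrix.

(** The rows of A with d i >= c are supported on the columns with d' j >= c. Hence the corresponding
    blocks of A and of the inverse matrix B still multiply to the identity, and a rank comparison
    gives the inequality. *)
Lemma iso_card_ge (I J : finType) (d : I -> int) (d' : J -> int) (c : int) :
  iso (sumO d : Omod k) (sumO d') ->
  (#|[pred i | (c <= d i)%R]| <= #|[pred j | (c <= d' j)%R]|)%N.
Proof.
move=> /iso_inv[f [g [fK _]]].
have [A [AE A0]] := sumO_hom_matrix f; have [B [BE _]] := sumO_hom_matrix g.
have AB i l : \sum_j A i j * B j l = (i == l)%:R.
  have w0 (i0 : I) : (1 : K) != 0 by exact: oner_neq0.
  have wP i' y (h : K) : opens_set off_infty y ->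
      twist_stalk (d i') y h <-> local_ring y (h / 1).
    by move=> yi; rewrite twist_stalk_finite// divr1.
  have [e eP] := sumO_basis w0 wP.
  have Gi : opens_set off_infty (Generic : P1 k) by [].
  have := BE _ (f off_infty (e i)) (exist _ Generic (mem_set Gi)) l.
  rewrite fK eP eq_sym => e'; transitivity (if i == l then 1 else 0 : K); last by case: eqP.
  rewrite e'; apply: eq_bigr => j _.
  rewrite AE (bigD1 i)//= big1 ?addr0 => [|i' ii'];
    by rewrite eP ?eqxx ?mul1r// (negbTE ii') mul0r.
set P := [pred i | _]; set Q := [pred j | _].
pose A' := \matrix_(a < #|P|, b < #|Q|) A (enum_val a) (enum_val b).
pose B' := \matrix_(b < #|Q|, a < #|P|) B (enum_val b) (enum_val a).
apply: (@mulmx1_min _ _ _ A' B'); apply/matrixP => a a'; rewrite !mxE.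
rewrite -(inj_eq enum_val_inj) -AB (bigID Q) /= [X in _ = _ + X]big1 => [|j].
  rewrite addr0 [RHS]big_enum_val; apply: eq_bigr => b _; rewrite !mxE//.
rewrite -ltNge => dj; rewrite A0 ?mul0r//.
by apply: lt_le_trans dj _; have := enum_valP a.
Qed.

Lemma iso_card_eq (I J : finType) (d : I -> int) (d' : J -> int) (c : int) :
  iso (sumO d : Omod k) (sumO d') -> #|[pred i | d i == c]| = #|[pred j | d' j == c]|.
Proof.
move=> E.
have split (L : finType) (e : L -> int) : (#|[pred i | (c <= e i)%R]| =
    #|[pred i | e i == c]| + #|[pred i | (c + 1 <= e i)%R]|)%N.
  rewrite -(cardID [pred i | e i == c]); congr addn; apply: eq_card => i; rewrite !inE.
    by case: eqVneq => [->|]; rewrite ?lexx ?andbT ?andbF.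
  by rewrite lezD1 lt_neqAle eq_sym.
have cardE c' : #|[pred i | (c' <= d i)%R]| = #|[pred j | (c' <= d' j)%R]|.
  apply/eqP; rewrite eqn_leq !iso_card_ge//; exact: iso_sym.
have := cardE c; rewrite !split cardE => /eqP; rewrite eqn_add2r => /eqP.
by [].
Qed.

End Splitting.

(** * Counting echelon forms *)

Lemma card_eq_pred (T : finType) (P : pred T) : ([set z | P z] #= `I_#|P|)%card.
Proof.
have -> : [set z | P z] = (fun a : 'I_#|P| => enum_val a) @` [set: 'I_#|P|].
  apply/seteqP; split=> [z Pz|z [a _ <-]]; last exact: enum_valP.
  by exists (enum_rank_in Pz z) => //; rewrite enum_rankK_in.
have -> : `I_#|P| = (fun a : 'I_#|P| => val a) @` [set: 'I_#|P|].
  by apply/seteqP; split=> [a ha|_ [a _ <-]]; [exists (Ordinal ha)|exact: ltn_ord].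
apply: card_eq_trans (inj_card_eq (in2W enum_val_inj)) _.
by rewrite card_eq_sym; exact: inj_card_eq (in2W val_inj).
Qed.

Section Inversions.
Variables (I : finType) (rho : I -> nat).
Implicit Types A B D : {set I}.

(** For D contained in A, the positions of the free entries of an echelon form. *)
Definition inversions A D :=
  [set z : I * I | [&& z.1 \in A :\: D, z.2 \in D & (rho z.2 < rho z.1)%N]]%SET.

Variable q : nat.

(* The term of D is the number of echelon forms, with respect to rho, of
   subspaces of codimension th of a space with basis A over a field with q
   elements. *)
Definition schubert_sum A th := (\sum_(D : {set I} | (D \subset A) && (#|D| == th))
  q ^ #|inversions A D|)%N.

Variables (m : nat) (lev : I -> 'I_m).
Hypothesis lev_rho : forall i j, (lev i < lev j)%N -> (rho j < rho i)%N.

Let L a := [set i | lev i == a]%SET.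

(** Pairs are sorted by the levels a, b of their members. For a < b every pair of an element outside
    D and one in D is an inversion, for a > b none is, and a = b gives the first sum. *)
Lemma card_inversions D : #|inversions [set: I] D| =
  ((\sum_a #|inversions (L a) (D :&: L a)|) +
   \sum_a (#|L a| - #|D :&: L a|) * \sum_(b < m | (a < b)%N) #|D :&: L b|)%N.
Proof.
pose S a b := [set z in inversions [set: I] D | (lev z.1 == a) && (lev z.2 == b)]%SET.
have cS : #|inversions [set: I] D| = (\sum_a \sum_b #|S a b|)%N.
  rewrite -sum1_card (partition_big (fun z => lev z.1) predT)//=.
  apply: eq_bigr => a _; rewrite (partition_big (fun z => lev z.2) predT)//=.
  apply: eq_bigr => b _; rewrite -sum1_card; apply: eq_bigl => z.
  by rewrite !inE -!andbA.
rewrite cS -big_split /=; apply: eq_bigr => a _.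
rewrite (bigD1 a)//=; congr addn.
  apply: eq_card => z; rewrite !inE.
  case: (lev z.1 == a); rewrite ?andbT ?andbF//=.
  by case: (lev z.2 == a); rewrite ?andbT ?andbF//= !andbT.
rewrite (bigID (fun b : 'I_m => (a < b)%N)) /= [X in (_ + X)%N]big1 ?addn0 => [|b /andP[ba ab]].
  rewrite big_distrr /=; apply: eq_big => [b|b /andP[_ ab]].
    by rewrite -val_eqE /=; case: ltngtP.
  have -> : (#|L a| - #|D :&: L a| = #|L a :\: D|)%N.
    by rewrite cardsD finset.setIC.
  rewrite -cardsX; apply: eq_card => -[i j]; rewrite !inE /=.
  case: (eqVneq (lev i) a) => [ia|]; rewrite ?andbF//=.
  case: (eqVneq (lev j) b) => [jb|]; rewrite ?andbF//= !andbT.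
  by rewrite (lev_rho (i:=i) (j:=j)) ?ia ?jb// andbT.
apply: eq_card0 => -[i j]; rewrite !inE /=; apply/negP.
move=> /andP[/and3P[_ _ ji] /andP[/eqP ia /eqP jb]].
have : (lev j < lev i)%N by rewrite ia jb ltn_neqAle val_eqE ba leqNgt.
by move=> /lev_rho; rewrite ltnNge (ltnW ji).
Qed.

(** A set D amounts to the family of its traces on the levels. Inversions between levels depend on
    the sizes of the traces only and factor out; distributivity turns the rest into a product. *)
Lemma sum_inversions (th : 'I_m -> nat) :
  (\sum_(D : {set I} | [forall a, #|D :&: L a| == th a]) q ^ #|inversions [set: I] D| =
   q ^ (\sum_a (#|L a| - th a) * \sum_(b < m | (a < b)%N) th b) *
   \prod_a schubert_sum (L a) (th a))%N.
Proof.
rewrite /schubert_sum bigA_distr_big_dep big_distrr /=.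
rewrite (reindex_onto (fun D : {set I} => [ffun a => D :&: L a])
  (fun f : {ffun 'I_m -> {set I}} => \bigcup_a f a)%SET) /=; last first.
  move=> f /familyP Hf; apply/ffunP => a; rewrite ffunE; apply/setP => i.
  rewrite !inE; apply/andP/idP => [[/bigcupP[b _ ib] /eqP ia]|ia].
    have := Hf b; rewrite unfold_in => /andP[/fintype.subsetP/(_ i ib)].
    by rewrite inE ia => /eqP ->.
  have := Hf a; rewrite unfold_in => /andP[/fintype.subsetP/(_ i ia)]; rewrite inE => h _.
  by split=> //; apply/bigcupP; exists a.
apply: eq_big => [D|D /forallP HD].
  apply/forallP/andP => [HD|[/familyP HD _] a].
    split.
      by apply/familyP => a; rewrite unfold_in ffunE finset.subsetIr HD.
    apply/eqP/setP => i; apply/bigcupP/idP => [[a _]|iD].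
      by rewrite ffunE inE => /andP[].
    by exists (lev i) => //; rewrite ffunE !inE iD eqxx.
  by have := HD a; rewrite unfold_in ffunE => /andP[].
rewrite card_inversions expnD mulnC; congr muln.
  congr expn; apply: eq_bigr => a _; rewrite (eqP (HD a)); congr muln.
  by apply: eq_bigr => b _; rewrite (eqP (HD b)).
by rewrite expn_sum; apply: eq_bigr => a _; rewrite ffunE.
Qed.

End Inversions.

Section Transport.
Variables (I J : finType) (f : J -> I) (f_inj : injective f) (rho : I -> nat) (q : nat).

Lemma schubert_sum_imset th :
  schubert_sum rho q (f @: [set: J])%SET th = schubert_sum (rho \o f) q [set: J]%SET th.
Proof.
rewrite /schubert_sum (reindex_onto (fun D : {set J} => f @: D)%SET
  (fun D : {set I} => f @^-1: D)%SET) /=; last first.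
  move=> D /andP[DA _]; apply/setP => i; apply/imsetP/idP => [[j + ->]|iD].
    by rewrite inE.
  have /imsetP[j _ ij] := fintype.subsetP DA i iD.
  by exists j; rewrite ?inE -?ij.
apply: eq_big => [D|D _].
  rewrite imsetS ?finset.subsetT// card_imset//= [X in _ && X](_ : _ = true) ?andbT//.
  by apply/eqP/setP => j; rewrite inE mem_imset.
congr expn.
rewrite -(card_imset (mem (inversions (rho \o f) [set: J]%SET D))
  (f := fun z => (f z.1, f z.2))).
  apply: eq_card => -[i j]; apply/idP/imsetP => [|[[i' j'] + [-> ->]]].
    rewrite !inE /= => /and3P[/andP[iD /imsetP[i' _ ii']] /imsetP[j' jD jj'] ji]; subst i j.
    exists (i', j') => //; rewrite !inE /= jD ji !andbT.
    by move: iD; rewrite mem_imset.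
  by rewrite !inE /= !mem_imset// !inE.
by move=> [a b] [c e] /= [/f_inj -> /f_inj ->].
Qed.

End Transport.

Section SchubertCell.
Variables (F : finFieldType) (I : finType) (rho : I -> nat).

Definition curry_mx (N : {ffun I * I -> F}) i j := N (i, j).

(** Echelon forms as finite functions supported on the inversions, so that their number is a power
    of #|F|. *)
Definition echelons (D : {set I}) :=
  pffun_on (0 : F) (mem (inversions rho [set: I]%SET D)) predT.

Lemma echelonsP D N : reflect (echelon rho D (curry_mx N)) (N \in echelons D).
Proof.
rewrite /echelons; set S := inversions rho _ D.
apply: (iffP (@pffun_onP _ _ 0 (mem S) (mem predT) N)) => [[sup _] i j Nij|eN].
  have : (i, j) \in support N by rewrite inE.
  by move=> /(fintype.subsetP sup); rewrite !inE /= => /and3P[/andP[]].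
split=> //; apply/fintype.subsetP => -[i j]; rewrite inE /= => /eN[iD jD ji].
by rewrite !inE /= iD jD ji.
Qed.

Lemma echelon_curry D N : echelon rho D N ->
  exists2 N' : {ffun I * I -> F}, N' \in echelons D & curry_mx N' = N.
Proof.
move=> eN; have E : curry_mx [ffun z => N z.1 z.2] = N.
  by apply/funext => i; apply/funext => j; rewrite /curry_mx ffunE.
by exists [ffun z => N z.1 z.2] => //; apply/echelonsP; rewrite E.
Qed.

Lemma card_echelon_pairs (P : pred {set I}) :
  #|[pred z : {set I} * {ffun I * I -> F} | P z.1 && (z.2 \in echelons z.1)]| =
  (\sum_(D | P D) #|F| ^ #|inversions rho [set: I]%SET D|)%N.
Proof.
rewrite -sum1_card (eq_bigr (fun D => \sum_(N | N \in echelons D) 1)%N); last first.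
  by move=> D _; rewrite sum1_card card_pffun_on cardT.
by rewrite pair_big_dep.
Qed.

End SchubertCell.

(** The graph is the kernel of a surjection onto a space of dimension #|D|, so its dimension follows
    by rank and nullity. *)
Lemma vspace_of_graph (k : fieldType) l (D : {set 'I_l}) (N : 'I_l -> 'I_l -> k) :
  exists L : {vspace 'rV[k]_l}, (forall v, v \in L <-> graph D N (v 0)) /\
    \dim L = (l - #|D|)%N.
Proof.
have [M [surj kerE]] := @comb_ker_graph k _ #|D| D N erefl.
have lin : linear (fun v : 'rV[k]_l => \sum_i v 0 i *: M i).
  move=> a v w; rewrite scaler_sumr -big_split /=; apply: eq_bigr => i _.
  by rewrite !mxE scalerDl scalerA.
pose f := linfun (mk_linear lin).
exists (lker f); split=> [v|].
  by rewrite -kerE memv_ker lfunE; split=> [/eqP|/eqP].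
have := limg_ker_dim f fullv; rewrite capfv.
have -> : limg f = fullv.
  apply/eqP; rewrite eqEsubv subvf /=; apply/subvP => w _.
  have [c cE] := surj w; apply/memv_imgP; exists (\row_i c i); first exact: memvf.
  by rewrite lfunE /= -cE; apply: eq_bigr => i _; rewrite mxE.
by rewrite !dimvf /dim /= !mul1n; exact: (canRL (addnK _)).
Qed.

(** Complementing D exchanges the two members of a pair, and reversing the order restores the
    inequality between them. The bound keeps the natural subtraction from truncating. *)
Lemma card_inversionsC (I : finType) (rho : I -> nat) n (D : {set I}) :
  (forall i, rho i <= n)%N ->
  #|inversions (fun i => n - rho i)%N [set: I]%SET (~: D)| = #|inversions rho [set: I]%SET D|.
Proof.
move=> rn; rewrite -(card_imset (mem (inversions rho _ D)) (f := fun z => (z.2, z.1))).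
  apply: eq_card => -[i j]; apply/idP/imsetP => [|[[i' j'] + [-> ->]]].
    rewrite !inE /= !negbK andbT => /and3P[iD jD ji]; exists (j, i) => //.
    by rewrite !inE /= iD jD; move: ji (rn i) (rn j); lia.
  rewrite !inE /= !negbK andbT => /and3P[iD jD ji].
  by rewrite iD jD; move: ji (rn i') (rn j'); lia.
by move=> [a b] [c e] /= [-> ->].
Qed.

Lemma card_Gr_schubert (F : finFieldType) (l : nat) (rho : 'I_l -> nat) th :
  injective rho -> (th <= l)%N ->
  card_Gr F th l = schubert_sum rho #|F| [set: 'I_l]%SET th.
Proof.
move=> rho_inj thl; pose n := (\max_i rho i)%N.
have rn i : (rho i <= n)%N by exact: leq_bigmax.
(* Dimension th means that D has l - th elements. With the reversed order, passing to complements
   gives sets of size th whose inversions are taken with respect to [rho]. *)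
pose rho' i := (n - rho i)%N.
have rho'_inj : injective rho'.
  by move=> i j e; apply: rho_inj; move: e (rn i) (rn j); rewrite /rho'; lia.
pose L (z : {set 'I_l} * {ffun 'I_l * 'I_l -> F}) :=
  projT1 (cid (vspace_of_graph z.1 (curry_mx z.2))).
have LP z : (forall v, v \in L z <-> graph z.1 (curry_mx z.2) (v 0)) /\
    \dim (L z) = (l - #|z.1|)%N := projT2 (cid (vspace_of_graph z.1 (curry_mx z.2))).
pose P := [pred z : {set 'I_l} * {ffun 'I_l * 'I_l -> F} |
  (#|z.1| == l - th)%N && (z.2 \in echelons F rho' z.1)].
have rowE c : (\row_i c i : 'rV[F]_l) 0 = c by apply/funext => i; rewrite mxE.
have Linj : {in [set z | P z] &, injective L}.
  move=> [D N] [D' N']; rewrite !inE => /andP[_ /echelonsP eN] /andP[_ /echelonsP eN'] e.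
  have [h _] := LP (D, N); have [h' _] := LP (D', N').
  have [|/= -> NE] := graph_inj eN eN'.
    apply/seteqP; split=> c hc.
      have : \row_i c i \in L (D, N) by apply/h; rewrite rowE.
      by rewrite e => /h'; rewrite rowE.
    have : \row_i c i \in L (D', N') by apply/h'; rewrite rowE.
    by rewrite -e => /h; rewrite rowE.
  congr pair; apply/ffunP => -[i j]; exact: (congr1 (fun M => M i j) NE).
have imL : [set V : {vspace 'rV[F]_l} | \dim V = th] = L @` [set z | P z].
  apply/seteqP; split=> [V dV|_ [z /andP[/eqP zD _] <-]]; last first.
    by have [_] := LP z; rewrite zD subKn.
  have lV : linear_set [set c : 'I_l -> F | \row_i c i \in V].
    split=> /=[|a c c' hc hc'].
      by rewrite (_ : \row_i _ = 0) ?mem0v//; apply/rowP => i; rewrite !mxE.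
    rewrite (_ : \row_i _ = a *: (\row_i c i) + \row_i c' i).
      by rewrite memvD// memvZ.
    by apply/rowP => i; rewrite !mxE.
  have [D [N [eN VE]]] := echelon_exists rho'_inj lV.
  have [N' N'e N'E] := echelon_curry eN.
  have [h dL] := LP (D, N').
  have LV : L (D, N') = V.
    apply/vspaceP => v; apply/idP/idP => [/h|vV].
      rewrite /= N'E -VE /=; congr (_ \in V); by apply/rowP => i; rewrite mxE.
    apply/h; rewrite /= N'E -VE /= (_ : \row_i _ = v)//.
    by apply/rowP => i; rewrite mxE.
  exists (D, N') => //=; rewrite N'e andbT -dV -LV dL /= subKn//.
  by rewrite -[l in leqRHS]card_ord max_card.
rewrite /card_Gr (_ : #|` _|%fset = #|P|); last first.
  apply: card_fset_set; rewrite imL; apply: card_eq_trans (inj_card_eq Linj) _.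
  exact: card_eq_pred.
rewrite (card_echelon_pairs F rho' (fun D : {set 'I_l} => #|D| == l - th)%N) /schubert_sum.
rewrite (reindex_inj (inv_inj (@finset.setCK _))) /=.
apply: eq_big => [D|D _]; last by rewrite card_inversionsC.
rewrite finset.subsetT /= cardsCs finset.setCK card_ord.
have := subset_leq_card (finset.subsetT D); rewrite cardsT card_ord => Dl.
move: Dl; move: #|D| => c cl.
by apply/eqP/eqP => [|->//] e; rewrite -(subKn cl) e subKn.
Qed.

(** * Hecke modifications *)

Section Hecke.
Variables (k : fieldType) (x : P1 k) (hx : closed [set x]) (hdeg : degree x 1).
Local Notation K := {fraction {poly k}}.
Variables (u : int -> K) (pi : K) (U0 : opens k) (fr : local_frame x u pi U0).
Variables (I : finType) (d : I -> int) (r : nat).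
Local Notation E := (sumO d : Omod k).
Local Notation sky := (skyscraper x r).
Local Notation graph_sub D N := (fiber_sub hdeg fr d (linear_graph D N)).

Lemma sub_incl_image (F : Omod k) (N : subsheaf F) U (s : F U) :
  in_image (sub_incl N) s <-> s \in @sub_pred k F N U.
Proof.
split=> [im|sN].
  have inj V : injective (sub_incl N V) by exact: val_inj.
  by have [t <-] := in_image_inj inj im; exact: valP.
exact: (image_in_image (sub_incl N) (SubSec sN)).
Qed.

Lemma sky_kernel_echelon (rho : I -> nat) (p : Defs.hom E sky) : injective rho ->
  (forall U (s : sky U), in_image p s) -> exists (D : {set I}) (N : I -> I -> k),
  [/\ echelon rho D N, #|D| = r &
      forall U (s : E U), p U s = 0 <-> s \in @sub_pred k E (graph_sub D N) U].
Proof.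
move=> rho_inj sur; have [M pM] := sky_hom_matrix hdeg fr p.
have /(sky_hom_surj hdeg hx fr pM) surM := sur.
have [D [N [eN kerE]]] := echelon_exists rho_inj (linear_comb_ker M).
exists D, N; split=> //; first exact: card_comb_ker surM kerE.
move=> U s; rewrite (sky_hom_eq0 hdeg fr pM) !fiber_subP.
by rewrite kerE.
Qed.

Lemma graph_sub_short_exact (D : {set I}) (N : I -> I -> k) : #|D| = r ->
  exists p : Defs.hom E sky, short_exact (sub_incl (graph_sub D N)) p.
Proof.
move=> Dr; have [M [surM kerE]] := comb_ker_graph N Dr.
have [p pM] := sky_hom_exists hdeg fr d M.
exists p; split=> [U|U s|].
- exact: val_inj.
- by rewrite sub_incl_image (sky_hom_eq0 hdeg fr pM) !fiber_subP kerE.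
- exact/(sky_hom_surj hdeg hx fr pM).
Qed.

Lemma hecke_modification_twist (rho : I -> nat) (E' : Omod k) : injective rho ->
  (forall i j, d i < d j -> (rho j < rho i)%N) ->
  hecke_modification x r E' E <-> exists D : {set I}, #|D| = r /\
    iso E' (sumO (fun i => d i - ((i \in D) : nat)%:Z)).
Proof.
move=> rho_inj rho_mono; split.
  move=> [i [p [inj ker sur]]].
  have [D [N [eN Dr pE]]] := sky_kernel_echelon rho_inj sur.
  exists D; split=> //.
  have h1 : iso E' (sheaf_of_sub (graph_sub D N)).
    by apply: (sub_iso inj) => U s; rewrite -pE; exact: ker.
  apply: iso_trans h1 _; apply: iso_sym; apply: twist_iso_fiber_sub => l j /eN[_ _ jl].
  by rewrite leNgt; apply/negP => /rho_mono; rewrite ltnNge (ltnW jl).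
(* The zero matrix is an echelon form for any D; its graph is a coordinate subspace, and one
   subspace of type D suffices here. *)
move=> [D [Dr E'E]]; pose N (i j : I) : k := 0.
have [p [inj ker sur]] := graph_sub_short_exact N Dr.
have [f fb] : iso E' (sheaf_of_sub (graph_sub D N)).
  apply: iso_trans E'E _; apply: twist_iso_fiber_sub => i j.
  by rewrite eqxx.
have [i iE] := hom_comp f (sub_incl (graph_sub D N)).
have iinj U : injective (i U).
  by move=> s t; rewrite !iE => /inj/(bij_inj (fb U)).
exists i, p; split=> // U s; rewrite ker; split=> im.
  have [t <-] := in_image_inj inj im; have [g _ gK] := fb U.
  by rewrite -[t]gK -iE; exact: image_in_image.
by have [t <-] := in_image_inj iinj im; rewrite iE; exact: image_in_image.
Qed.

End Hecke.

(** * Degrees of twisted sums and their isomorphism classes *)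

Section Multiplicities.
Variable n : nat.
Implicit Types (d e : 'I_n -> int) (D : {set 'I_n}).

Lemma degree_rank d : exists rho : 'I_n -> nat, injective rho /\
  forall i j, d i < d j -> (rho j < rho i)%N.
Proof.
(* The index breaks ties between equal degrees, so that the number of predecessors is an injective
   rank. *)
pose gt i j := (d i < d j) || ((d i == d j) && (j < i)%N).
have gt_trans i j l : gt i j -> gt j l -> gt i l.
  rewrite /gt => /orP[ij|/andP[/eqP -> ji]] /orP[jl|/andP[/eqP <- lj]].
  - by rewrite (lt_trans ij jl).
  - by rewrite ij.
  - by rewrite jl.
  - by rewrite eqxx (ltn_trans lj ji) orbT.
have gt_irr i : gt i i = false by rewrite /gt ltxx ltnn andbF.
pose rho i := #|[set j | gt i j]%SET|.
have rhoP i j : gt i j -> (rho j < rho i)%N.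
  move=> ij; apply: proper_card; apply/fintype.properP; split.
    by apply/fintype.subsetP => l; rewrite !inE; exact: gt_trans ij.
  by exists j; rewrite inE ?gt_irr.
exists rho; split=> [i j e|i j ij]; last by apply: rhoP; rewrite /gt ij.
apply/eqP/negPn/negP => nij; have : gt i j || gt j i.
  rewrite /gt; case: (ltgtP (d i) (d j)) => //= _.
  by rewrite -neq_ltn eq_sym.
by move=> /orP[] /rhoP; rewrite e ltnn.
Qed.

Lemma iso_perm (k : fieldType) d e :
  (forall c, #|[pred i | d i == c]| = #|[pred i | e i == c]|) ->
  iso (sumO d : Omod k) (sumO e).
Proof.
move=> de.
have cnt (f : 'I_n -> int) c : count_mem c [tuple f i | i < n] = #|[pred i | f i == c]|.
  rewrite /= count_map cardE enumT /enum_mem size_filter.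
  by apply: eq_count => i; rewrite /= !inE.
have : perm_eq [tuple e i | i < n] [tuple d i | i < n].
  by apply/allP => c _; rewrite /= !cnt de.
move=> /tuple_permP[s sE]; have es i : e i = d (s i).
  have := congr1 (fun t : seq int => nth 0 t i) sE.
  by rewrite -!tnth_nth !tnth_mktuple.
have tP U (t : sumO d U) : (fun y i => sumO_val t y (s i)) \in @sumO_pred k 'I_n e U.
  apply/asboolP; split=> [y z|y i]; first by rewrite (sumO_const t y z).
  by rewrite es; exact: sumO_twist.
have tP' U (t : sumO e U) : (fun y i => sumO_val t y ((s^-1)%g i)) \in @sumO_pred k 'I_n d U.
  apply/asboolP; split=> [y z|y i]; first by rewrite (sumO_const t y z).
  by rewrite -[i in d i](permKV s) -es; exact: sumO_twist.
have slin U : linear (fun t : sumO d U => SumO (tP U t) : sumO e U).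
  by move=> a v w; exact: val_inj.
have fres (U V : opens k) (h : V `<=` U) (t : sumO d U) :
    mk_linear (slin V) (res h t) = res h (mk_linear (slin U) t) by exact: val_inj.
exists (@Defs.Hom k (sumO d) (sumO e) (fun U => mk_linear (slin U)) fres) => U.
exists (fun t => SumO (tP' U t)) => t; apply: val_inj; apply/funext => y; apply/funext => i /=.
  by rewrite permKV.
by rewrite permK.
Qed.

Definition twisted d D i : int := d i - ((i \in D) : nat)%:Z.

Lemma card_twisted d D c : #|[pred i | twisted d D i == c]| =
  (#|[pred i | d i == c]| - #|[pred i | (d i == c) && (i \in D)]| +
   #|[pred i | (d i == (c + 1)%R) && (i \in D)]|)%N.
Proof.
rewrite -(cardID (mem D)) addnC; congr addn.
  rewrite -(cardID (mem D) [pred i | d i == c]).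
  rewrite [X in _ = (X + _ - _)%N](_ : _ = #|[pred i | (d i == c) && (i \in D)]|).
    rewrite addKn; apply: eq_card => i; rewrite !inE /twisted.
    by case: (i \in D); rewrite // subr0.
  by apply: eq_card => i; rewrite !inE.
apply: eq_card => i; rewrite !inE /twisted.
by case: (i \in D); rewrite ?andbF// !andbT subr_eq.
Qed.

(** Twisting moves the elements of D down by one degree, so the summands of degree c involve D in
    degrees c and c + 1 only. Descending induction from above all degrees recovers the number of
    elements of D in each degree. *)
Lemma card_twisted_eq d D D' :
  (forall c, #|[pred i | twisted d D i == c]| = #|[pred i | twisted d D' i == c]|) <->
  (forall c, #|[pred i | (d i == c) && (i \in D)]| = #|[pred i | (d i == c) && (i \in D')]|).
Proof.
split=> [h|h c]; last by rewrite !card_twisted !h.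
have [B dB] : exists B : int, forall i, d i < B.
  exists (\sum_i `|d i| + 1) => i; apply: (@le_lt_trans _ _ `|d i|); first exact: ler_norm.
  by rewrite (bigD1 i)//= -addrA ltr_pwDr// ltr_wpDl// sumr_ge0.
have small D1 c : (#|[pred i | (d i == c) && (i \in D1)]| <= #|[pred i | d i == c]|)%N.
  by apply: subset_leq_card; apply/fintype.subsetP => i; rewrite !inE => /andP[].
suff H m : forall c, B <= c + m%:Z ->
    #|[pred i | (d i == c) && (i \in D)]| = #|[pred i | (d i == c) && (i \in D')]|.
  move=> c; apply: (H `|(B - c)%R|%N); rewrite addrC -lerBlDr.
  by rewrite abszE ler_norm.
elim: m => [|m IH] c Bc.
  have out D1 : #|[pred i | (d i == c) && (i \in D1)]| = 0%N.
    apply: eq_card0 => i; rewrite !inE; apply/negP => /andP[/eqP dc _].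
    by have := dB i; rewrite dc ltNge; rewrite addr0 in Bc; rewrite Bc.
  by rewrite !out.
have := h c; rewrite !card_twisted (IH (c + 1)); last by rewrite -addrA -intS.
move=> /eqP; rewrite eqn_add2r => /eqP e.
by rewrite -(subKn (small D c)) e subKn.
Qed.

End Multiplicities.

(** Finiteness is given by a cardinality only, while the count runs over finite types. The equality
    of fields allows k to be replaced throughout by a finite field structure on it. *)
Lemma finite_finFieldType (k : fieldType) q : ([set: k] #= `I_q)%card ->
  exists F : finFieldType, (F : fieldType) = k /\ #|F| = q.
Proof.
move=> kq; have kfin : finite_set [set: k] by exists q.
have [e [ue me se]] : exists e : seq k, [/\ uniq e, forall c, c \in e & size e = q].
  exists (fset_set [set: k]); split; first exact: fset_uniq.
    by move=> c; rewrite in_fset_set// inE.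
  exact: card_fset_set kq.
case: k kq kfin e ue me se => T c kq kfin e ue me se.
pose k := GRing.Field.Pack c.
have pk : pcancel (fun y : k => index y e) (fun i => nth None (map some e) i).
  by move=> y; rewrite (nth_map 0) ?nth_index ?index_mem ?me//; exact: me.
have cnt : Finite.axiom (e : seq k) by move=> y; rewrite count_uniq_mem// me.
pose F : finFieldType := HB.pack_for finFieldType T k
  (Choice_isCountable.Build k pk) (isFinite.Build k cnt).
exists F; split; first by [].
rewrite -se cardE; apply: perm_size; apply: uniq_perm => //; first exact: enum_uniq.
by move=> y; rewrite mem_enum me.
Qed.

Lemma split_card (k : fieldType) n m (d : 'I_n -> int) (b : 'I_m -> int) (l : 'I_m -> nat) :
  (forall i j : 'I_m, (i < j)%N -> b i < b j) ->
  iso (sumO d : Omod k) (sumO (fun ij : {i : 'I_m & 'I_(l i)} => b (tag ij))) ->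
  (forall j, #|[pred i | d i == b j]| = l j) /\
  exists lev : 'I_n -> 'I_m, forall i, d i = b (lev i).
Proof.
move=> bmono dE.
have b_inj : injective b.
  by move=> i j e; case: (ltngtP i j) => [/bmono|/bmono|/val_inj//]; rewrite e ltxx.
split=> [j|].
  rewrite (iso_card_eq _ dE) -[RHS]card_ord.
  have inj : injective (fun a : 'I_(l j) => Tagged (fun i => 'I_(l i)) a).
    by move=> a a' /eqP; rewrite eq_Tagged => /eqP.
  rewrite -(card_codom inj); apply: eq_card => -[i a]; rewrite !inE /= (inj_eq b_inj).
  apply/eqP/codomP => [e|[a' /eqP]]; first by subst i; exists a.
  by rewrite -tag_eqE /tag_eq /= => /andP[/eqP].
suff /choice[lev levP] : forall i, exists j, d i = b j by exists lev.
move=> i; have := iso_card_eq (d i) dE.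
have : (0 < #|[pred j | d j == d i]|)%N by apply/card_gt0P; exists i; rewrite inE.
by move=> /[swap] -> /card_gt0P[z]; rewrite inE => /eqP <-; exists (tag z).
Qed.

(** * Counting Hecke subsheaves over a finite field *)

Section Count.
Variables (F : finFieldType) (x : P1 F) (hx : closed [set x]) (hdeg : degree x 1).
Local Notation K := {fraction {poly F}}.
Variables (u : int -> K) (pi : K) (U0 : opens F) (fr : local_frame x u pi U0).
Variables (n : nat) (d : 'I_n -> int) (r : nat).
Variables (delta : 'I_n -> bool) (E' : Omod F).
Hypothesis delta_r : #|[set i | delta i]%SET| = r.
Hypothesis E'vb : vector_bundle n E'.
Hypothesis E'E : iso E' (sumO (fun i => d i - (delta i : nat)%:Z)).
Variables (rho : 'I_n -> nat) (rho_inj : injective rho).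
Hypothesis rho_mono : forall i j, d i < d j -> (rho j < rho i)%N.

Let D0 := [set i | delta i]%SET.

(** The form given by [card_twisted_eq] to the condition that the twists by D and D0 be
    isomorphic. *)
Let same_type (D : {set 'I_n}) :=
  forall c, #|[pred i | (d i == c) && (i \in D)]| = #|[pred i | (d i == c) && (i \in D0)]|.

Let hecke_sub (z : {set 'I_n} * {ffun 'I_n * 'I_n -> F}) :=
  fiber_sub hdeg fr d (linear_graph z.1 (curry_mx z.2)).

Lemma twistedE : iso E' (sumO (twisted d D0)).
Proof.
by move: E'E; congr (iso _ (sumO _)); apply/funext => i; rewrite /twisted inE.
Qed.

Lemma same_type_iso D N : echelon rho D N ->
  same_type D <-> iso E' (sheaf_of_sub (fiber_sub hdeg fr d (linear_graph D N))).
Proof.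
move=> eN.
have tw : iso (sumO (twisted d D)) (sheaf_of_sub (fiber_sub hdeg fr d (linear_graph D N))).
  apply: twist_iso_fiber_sub => i j /eN[_ _ ji].
  by rewrite leNgt; apply/negP => /rho_mono; rewrite ltnNge (ltnW ji).
rewrite /same_type -card_twisted_eq; split=> h.
  apply: iso_trans tw; apply: iso_trans twistedE _.
  by apply: iso_perm => c; rewrite h.
have e : iso (sumO (twisted d D) : Omod F) (sumO (twisted d D0)).
  exact: iso_trans tw (iso_trans (iso_sym h) twistedE).
by move=> c; exact: iso_card_eq e.
Qed.

Lemma same_type_card D : same_type D -> #|D| = r.
Proof.
move=> h; rewrite -delta_r -!sum1_card.
have big (A : {set 'I_n}) : (\sum_(i in A) 1 =
    \sum_(c <- undup [seq d i | i : 'I_n]) #|[pred i | (d i == c) && (i \in A)]|)%N.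
  rewrite (eq_bigr (fun c => \sum_(i | (d i == c) && (i \in A)) 1)%N); last first.
    by move=> c _; rewrite sum1_card.
  rewrite (exchange_big_dep (mem A)) /=; last by move=> c i _ /andP[].
  apply: eq_bigr => i iA; rewrite (eq_bigl (pred1 (d i))).
    rewrite big_const_seq iter_addn_0 mul1n count_uniq_mem ?undup_uniq//.
    by rewrite mem_undup fintype.image_f.
  by move=> c; rewrite /= iA andbT eq_sym.
by rewrite !big; apply: eq_bigr => c _; exact: h.
Qed.

Lemma hecke_subsheavesE : hecke_subsheaves x r E' (sumO d) =
  hecke_sub @` [set z | same_type z.1 /\ z.2 \in echelons F rho z.1].
Proof.
apply/seteqP; split=> [N [_ NE' [p [inj ker sur]]]|_ [[D N] [Dt /echelonsP eN] <-]].
  have [D [N' [eN' Dr pE]]] := sky_kernel_echelon hx hdeg fr rho_inj sur.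
  (* A Hecke subsheaf is the kernel of its map to the skyscraper sheaf, hence the subsheaf of a
     graph. *)
  have NE : N = fiber_sub hdeg fr d (linear_graph D N').
    by apply: subsheaf_eq => U s; rewrite -pE -sub_incl_image ker.
  have [N'' N''e N''E] := echelon_curry eN'.
  exists (D, N''); last by rewrite /hecke_sub NE /= N''E.
  by split=> //=; apply/(same_type_iso eN'); rewrite -NE; exact: iso_sym.
have isoN := (same_type_iso eN).1 Dt.
split; [exact: coherent_iso E'vb isoN|exact: iso_sym|].
by apply: graph_sub_short_exact => //; exact: same_type_card.
Qed.

Lemma hecke_sub_inj :
  {in [set z | same_type z.1 /\ z.2 \in echelons F rho z.1] &, injective hecke_sub}.
Proof.
move=> [D N] [D' N']; rewrite !inE => -[_ /echelonsP eN] [_ /echelonsP eN'].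
move=> /fiber_sub_inj/(graph_inj eN eN')[/= -> NE].
congr pair; apply/ffunP => -[i j]; exact: (congr1 (fun M => M i j) NE).
Qed.

Variables (m : nat) (b : 'I_m -> int) (l : 'I_m -> nat).
Hypothesis bmono : forall i j : 'I_m, (i < j)%N -> b i < b j.
Hypothesis dE :
  iso (sumO d : Omod F) (sumO (fun ij : {i : 'I_m & 'I_(l i)} => b (tag ij))).

Let theta (j : 'I_m) := #|[set i | (d i == b j) && delta i]%SET|.

Lemma card_hecke_subsheaves : (hecke_subsheaves x r E' (sumO d) #=
  `I_(#|F| ^ (\sum_(j < m) (l j - theta j) * (r - \sum_(i < m | i <= j) theta i)) *
      \prod_(j < m) card_Gr F (theta j) (l j))%N)%card.
Proof.
have [lE [lev levE]] := split_card bmono dE.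
have b_inj : injective b.
  by move=> i j e; case: (ltngtP i j) => [/bmono|/bmono|/val_inj//]; rewrite e ltxx.
have lev_rho i j : (lev i < lev j)%N -> (rho j < rho i)%N.
  by move=> ij; apply: rho_mono; rewrite !levE; exact: bmono.
pose L a := [set i | lev i == a]%SET.
have Lc i a : (d i == b a) = (i \in L a) by rewrite inE levE (inj_eq b_inj).
have cL a : #|L a| = l a.
  by rewrite -lE; apply: eq_card => i; rewrite [RHS]inE Lc.
have thE a : theta a = #|D0 :&: L a|.
  by apply: eq_card => i; rewrite [LHS]inE Lc finset.in_setI andbC [i \in D0]inE.
have thl a : (theta a <= #|L a|)%N.
  by rewrite thE; apply: subset_leq_card; exact: finset.subsetIr.
pose P (D : {set 'I_n}) := [forall a, #|D :&: L a| == theta a]%N.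
(* All degrees occurring in d are among the b a, so the condition on every integer c reduces to one
   condition for each level. *)
have PE : [set z | same_type z.1 /\ z.2 \in echelons F rho z.1] =
    [set z : {set 'I_n} * {ffun 'I_n * 'I_n -> F} | P z.1 && (z.2 \in echelons F rho z.1)].
  apply/seteqP; split=> -[D N] /= => [[h ->]|/andP[/forallP h ->]].
    rewrite andbT; apply/forallP => a; rewrite thE; apply/eqP.
    have cE (A : {set 'I_n}) : #|A :&: L a| = #|[pred i | (d i == b a) && (i \in A)]|.
      by apply: eq_card => i; rewrite [RHS]inE Lc finset.in_setI andbC.
    by rewrite !cE h.
  split=> // c; have [[i di]|no] := pselect (exists i, d i = c); last first.
    by rewrite !eq_card0// => i; rewrite !inE; apply/negP => /andP[/eqP di]; case: no; exists i.
  have cE (A : {set 'I_n}) : #|[pred i | (d i == c) && (i \in A)]| = #|A :&: L (lev i)|.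
    by apply: eq_card => j; rewrite [LHS]inE -di (levE i) Lc finset.in_setI andbC.
  by rewrite !cE (eqP (h (lev i))) thE.
rewrite hecke_subsheavesE.
apply: card_eq_trans (inj_card_eq hecke_sub_inj) _; rewrite PE.
apply: card_eq_trans (card_eq_pred _) _; rewrite card_echelon_pairs.
rewrite /P (sum_inversions #|F| lev_rho).
(* Since r is the total of the [theta], subtracting those up to a leaves the sum over higher levels,
   without truncation; this identifies the exponent with [alpha]. *)
have rE : r = (\sum_a theta a)%N.
  rewrite -delta_r -sum1_card (partition_big lev predT)//=.
  apply: eq_bigr => a _; rewrite thE -sum1_card; apply: eq_bigl => i.
  by rewrite finset.in_setI [i \in L a]inE.
rewrite (eq_bigr (fun a => (l a - theta a) * (r - \sum_(i < m | i <= a) theta i))%N).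
  rewrite [X in (_ * X)%N](eq_bigr (fun a => card_Gr F (theta a) (l a))).
    exact: card_eqxx.
  move=> a _; rewrite -cL.
  (* Each level is numbered in order to compare it with a Grassmannian. The order induced on it by
     [rho] need not be that of the numbering: the Grassmannian count holds for every injective
     rank. *)
  have LE : L a = (enum_val @: [set: 'I_#|L a|])%SET.
    apply/setP => i; apply/idP/imsetP => [iL|[c _ ->]]; last exact: enum_valP.
    by exists (enum_rank_in iL i); rewrite ?inE// enum_rankK_in.
  transitivity (schubert_sum rho #|F| (L a) (theta a)); first by [].
  rewrite [in LHS]LE schubert_sum_imset; last exact: enum_val_inj.
  by apply/esym/card_Gr_schubert; [move=> s t /rho_inj/enum_val_inj|exact: thl].
move=> a _; rewrite -[[set i | lev i == a]%SET]/(L a) cL; congr muln.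
rewrite rE [X in _ = (X - _)%N](bigID (fun i : 'I_m => (i <= a)%N)) /= addKn.
by apply: eq_bigl => c; rewrite ltnNge.
Qed.

End Count.

Theorem theorem2 (k : fieldType) (x : P1 k) (hx : closed [set x])
    (hdeg : degree x 1) (r n : nat) (hr : (0 < r)%N) (d : 'I_n -> int) :
  (forall E' : Omod k, vector_bundle n E' ->
     (hecke_modification x r E' (sumO d) <->
      exists delta : 'I_n -> bool,
        #|[set i | delta i]%SET| = r /\
        iso E' (sumO (fun i => d i - (delta i : nat)%:Z)))) /\
  (forall q : nat, ([set: k] #= `I_q)%card ->
   forall (m : nat) (b : 'I_m -> int) (l : 'I_m -> nat),
     (forall i j : 'I_m, (i < j)%N -> b i < b j) ->
     iso (sumO d : Omod k) (sumO (fun ij : {i : 'I_m & 'I_(l i)} => b (tag ij))) ->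
   forall (delta : 'I_n -> bool) (E' : Omod k),
     #|[set i | delta i]%SET| = r ->
     vector_bundle n E' ->
     iso E' (sumO (fun i => d i - (delta i : nat)%:Z)) ->
     let theta (j : 'I_m) := #|[set i | (d i == b j) && delta i]%SET| in
     let alpha :=
       (\sum_(j < m) (l j - theta j) * (r - \sum_(i < m | i <= j) theta i))%N in
     (hecke_subsheaves x r E' (sumO d) #=
        `I_(q ^ alpha * \prod_(j < m) card_Gr k (theta j) (l j))%N)%card).
Proof.
have [rho [rho_inj rho_mono]] := degree_rank d.
split=> [E' _|q kq].
  have [u [pi [U0 fr]]] := local_frame_exists hx hdeg.
  rewrite (hecke_modification_twist hx hdeg fr r E' rho_inj rho_mono).
  split=> [[D [Dr E'D]]|[delta [dr E'd]]].
    exists (mem D); split=> //; rewrite -Dr.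
    by apply: eq_card => i; rewrite inE.
  exists [set i | delta i]%SET; split=> //.
  by congr (iso _ (sumO _)): E'd; apply/funext => i; rewrite inE.
have [F [Fk <-]] := finite_finFieldType kq; subst k.
move=> m b l bmono dE delta E' delta_r E'vb E'E.
have [u [pi [U0 fr]]] := local_frame_exists hx hdeg.
exact: (card_hecke_subsheaves hx hdeg fr delta_r E'vb E'E rho_inj rho_mono bmono dE).
Qed.
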